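(* Let $T\in\mathbb Z_{>0}$, and let $$N_1(T)=\left|\{\Lambda_\tau : \Lambda_\tau \text{ is arithmetic and } \mathfrak m(\Lambda_\tau)\le T\}\right|,$$ $$N_2(T)=\left|\{\Lambda_\tau : \Lambda_\tau \text{ is arithmetic semi-stable and } \mathfrak m(\Lambda_\tau)\le T\}\right|,$$ $$N_3(T)=\left|\{\Lambda_\tau : \Lambda_\tau \text{ is arithmetic WR and } \mathfrak m(\Lambda_\tau)\le T\}\right|,$$ where $\tau$ ranges over $\mathcal F$. Then $N_1(T)>N_2(T)>N_3(T)$, and as $T\to\infty$, $$N_1(T)=\frac{39\,T^4}{8\pi^4}+O(T^3\log T),$$ and $$N_2(T)=\frac{3\,T^4}{8\pi^4}+O(T^3\log T),$$ while $$N_3(T)=\frac{3\,T^2}{2\pi^2}+O(T\log T).$$ Notice that $\frac{39}{8\pi^4}=0.05004666349\ldots$ and $\frac{3}{8\pi^4}=0.00384974334\ldots$ In particular, about $7.7\%$ of arithmetic similarity classes in the plane are semi-stable.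
   Context: Lattices are full-rank lattices in $\mathbb R^2$. Two lattices $L,M$ are similar if $L=\alpha U M$ for some real $\alpha>0$ and some real orthogonal $2\times 2$ matrix $U$. Let $\mathcal F=\{\tau=x+iy\in\mathbb C: y\ge 0,\ 0\le x\le 1/2,\ |\tau|\ge 1\}$ and, for $\tau=x+iy\in\mathcal F$, let $\Lambda_\tau=\begin{pmatrix}1&x\\0&y\end{pmatrix}\mathbb Z^2$. Every lattice in $\mathbb R^2$ is similar to $\Lambda_\tau$ for exactly one $\tau\in\mathcal F$, so the lattices $\Lambda_\tau$, $\tau\in\mathcal F$, represent the similarity classes. A lattice $L=A\mathbb Z^2$, with $A$ a $2\times 2$ basis matrix, is arithmetic if the entries of $A^tA$ span a one-dimensional vector space over $\mathbb Q$ (this is independent of the choice of $A$). The successive minima $0<\lambda_1(L)\le\lambda_2(L)$ are $\lambda_i(L)=\min\{r>0:\dim_{\mathbb R}\operatorname{span}_{\mathbb R}(\mathbb B(r)\cap L)\ge i\}$, where $\mathbb B(r)$ is the (closed) disk of radius $r$ centered at the origin. $L$ is well-rounded (WR) if $\lambda_1(L)=\lambda_2(L)$, and semi-stable if $\lambda_1(L)\ge\det(L)^{1/2}$, where $\det(L)=|\det A|$. The properties of being arithmetic, WR, and semi-stable are each preserved under similarity. Similarity classes of arithmetic lattices correspond to the $\Lambda_\tau$ with $\tau\in\mathcal F$ of the form $\tau=\tau(a,b,c,d)=\frac ab+i\sqrt{\frac cd}$ for integers $a,b,c,d$ such that $\gcd(a,b)=\gcd(c,d)=1$, $0\le a\le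 b/2$, and $c/d\ge 1-a^2/b^2$. The maximum height of such an arithmetic similarity class is $\mathfrak m(\Lambda_{\tau(a,b,c,d)})=\max\{|a|,|b|,|c|,|d|\}$.
   Formalization: The strict inequalities are stated for T ≥ 2, since all three counts equal 1 at T = 1; a WR class has maximum height b², so N_3(T) grows linearly and its asymptotic is corrected to 3T/(2π²) + O(√T log T). *)

(* Defs.v *)
From HB Require Import structures.
From mathcomp Require Import all_boot all_order all_algebra.
From mathcomp Require Import finmap.
From mathcomp Require Import all_classical all_reals all_analysis.
From mathcomp Require Import complex.
Set Implicit Arguments.
Unset Strict Implicit.
Unset Printing Implicit Defensive.
Import Order.TTheory GRing.Theory Num.Theory.
Import numFieldNormedType.Exports.
Local Open Scope classical_set_scope.
Local Open Scope ring_scope.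

Section Lattices.
Variable R : realType.
Implicit Types (L : set 'cV[R]_2) (A : 'M[R]_2) (tau : R[i]).

Definition lattice_of A : set 'cV[R]_2 :=
  [set A *m map_mx intr z | z in [set: 'cV[int]_2]].

Definition is_basis A L : Prop := A \in unitmx /\ L = lattice_of A.

(* The norm that the library puts on matrices is the sup norm. *)
Definition enorm (v : 'cV[R]_2) : R := Num.sqrt (\sum_i v i 0 ^+ 2).

Definition disk (r : R) : set 'cV[R]_2 := [set v | enorm v <= r].

Definition is_span (S : set 'cV[R]_2) (U : {vspace 'cV[R]_2}) : Prop :=
  (forall v, S v -> v \in U) /\
  (forall W : {vspace 'cV[R]_2}, (forall v, S v -> v \in W) -> (U <= W)%VS).

(* For a lattice and i <= 2 this infimum is attained. *)
Definition succ_min (i : nat) L : R :=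
  inf [set r | 0 < r /\
    exists2 U : {vspace 'cV[R]_2}, is_span (disk r `&` L) U & (i <= \dim U)%N].

Definition well_rounded L : Prop := succ_min 1 L = succ_min 2 L.

(* The covolume |det A| does not depend on the basis A of L. *)
Definition semi_stable L : Prop :=
  exists2 A, is_basis A L & Num.sqrt `|\det A| <= succ_min 1 L.

Definition rat_span_entries (G : 'M[R]_2) : set R :=
  [set \sum_i \sum_j ratr (q i j) * G i j | q in [set: 'M[rat]_2]].

Definition rat_line (t : R) : set R := [set ratr q * t | q in [set: rat]].

Definition arithmetic L : Prop :=
  exists2 A, is_basis A L &
    exists2 t, t != 0 & rat_span_entries (A^T *m A) = rat_line t.

Definition fund_dom : set R[i] :=
  [set tau | [/\ 0 <= complex.Im tau, 0 <= complex.Re tau <= 1 / 2 & 1 <= `|tau|]].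

Definition Lambda_mx tau : 'M[R]_2 :=
  \matrix_(i, j) if i == 0 then (if j == 0 then 1 else complex.Re tau)
                 else (if j == 0 then 0 else complex.Im tau).

Definition Lambda tau : set 'cV[R]_2 := lattice_of (Lambda_mx tau).

Definition tau_of (a b c d : int) : R[i] :=
  (a%:~R / b%:~R +i* Num.sqrt (c%:~R / d%:~R))%C.

Definition admissible (a b c d : int) : Prop :=
  [/\ b != 0 /\ d != 0,
      coprimez a b /\ coprimez c d,
      0 <= a /\ a%:~R <= b%:~R / 2 :> R &
      1 - a%:~R ^+ 2 / b%:~R ^+ 2 <= c%:~R / d%:~R :> R].

(* (a, b) is determined by L, and (c, d) up to a common sign, so an arithmetic
   similarity class has exactly one maximum height. *)
Definition has_max_height L (h : nat) : Prop :=
  exists a b c d : int, [/\ admissible a b c d, L = Lambda (tau_of a b c d) &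
    h = maxn (maxn `|a|%N `|b|%N) (maxn `|c|%N `|d|%N)].

Definition arith_le (T : nat) : set (set 'cV[R]_2) :=
  [set L | [/\ (Lambda @` fund_dom) L, arithmetic L &
               exists2 h, has_max_height L h & (h <= T)%N]].

(* These sets are finite; the cardinal of [fset_set] of an infinite set is 0. *)
Definition N1 (T : nat) : nat := #|` fset_set (arith_le T)|.

Definition N2 (T : nat) : nat :=
  #|` fset_set (arith_le T `&` [set L | semi_stable L])|.

(* A well-rounded class has y ^ 2 = (b ^ 2 - a ^ 2) / b ^ 2 in lowest terms, so
   that its maximum height is b ^ 2 and N3 grows linearly. *)
Definition N3 (T : nat) : nat :=
  #|` fset_set (arith_le T `&` [set L | well_rounded L])|.

(* x = 0.s_1 s_2 ... s_n ... (truncated decimal expansion) *)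
Definition decimal_prefix (s : seq nat) (x : R) : Prop :=
  let p := \sum_(i < size s) (nth 0%N s i)%:R / 10 ^+ i.+1 in
  p <= x < p + 1 / 10 ^+ size s.

End Lattices.

Arguments N1 R T : clear implicits.
Arguments N2 R T : clear implicits.
Arguments N3 R T : clear implicits.

(* Main.v *)
Require Import Defs.
From mathcomp Require Import all_boot all_order all_algebra.
From mathcomp Require Import finmap.
From mathcomp Require Import all_classical all_reals all_analysis.
From mathcomp Require Import complex zify ring lra.
Import Order.TTheory GRing.Theory Num.Theory.
Import numFieldNormedType.Exports.
Local Open Scope classical_set_scope.
Local Open Scope ring_scope.

(** Two points of the fundamental domain give the same set only if they are
    equal, so N1, N2, N3 count quadruples (a, b, c, d) with a / b and c / d
    reduced; such a class is semi-stable iff c <= d, and well rounded iff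
    (c, d) = (b^2 - a^2, b^2).  Hence N2 is a sum over reduced a / b <= 1 / 2 of
    the number of reduced c / d in [1 - (a / b)^2, 1], N1 - N2 is the product of
    the number of reduced a / b <= 1 / 2 by that of reduced d / c < 1, and N3 is
    the number of reduced a / b <= 1 / 2 with b <= sqrt T.
    A sum over coprime pairs 0 <= a <= b <= T of a function of a / b is, by
    Moebius inversion, al T^2 / zeta(2) + O(T log T) as soon as the sum over all
    pairs is al T^2 + O(T).  The value zeta(2) = pi^2 / 6 comes from halving
    angles in sums of 1 / sin^2. *)

(** * Moebius inversion over triangles *)


(** For N2 the inner estimate has to be uniform in x = a / b: the number of reduced c / d in
    [1 - x^2, 1] is (x^2 / 2) T^2 / zeta(2) up to an error whose constant does not depend on x.
    Summing over O(T^2) values of x then costs only O(T^3 log T), and the main terms form a second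
    coprime sum, now with weight x^2. The constants are row averages, a row sum close to 2 al b
    giving al T^2: al = 1/4 for x <= 1/2, al = 1/2 for all x, al = 1/48 for the weight x^2 on x <=
    1/2. With 1 / zeta(2) = 6 / pi^2 this yields (1/2) (1/48) 36 / pi^4 = 3 / (8 pi^4) for N2, (1/4)
    (1/2) 36 / pi^4 = 36 / (8 pi^4) for N1 - N2, hence the ratio 3 / 39, and (1/4) 6 / pi^2 for N3.
    The counting estimates are inequalities with explicit constants for every T >= 1; Landau
    notation enters only at the end. The logarithm is a harmonic sum of errors O(T / k), and
    infinite sums of Moebius values are avoided by truncated convolutions that are exact for each
    T. *)

Definition moebius (n : nat) : int :=
  if all (fun p => logn p n <= 1)%N (primes n) then (-1) ^+ size (primes n) else 0.

Lemma norm_moebius (n : nat) : `|moebius n| <= 1.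
Proof.
by rewrite /moebius; case: ifP => _; rewrite ?normr0// normrX normrN1 expr1n.
Qed.

Lemma moebius_prime_mul (p j : nat) : prime p -> (0 < j)%N ->
  moebius (p * j) = if (p %| j)%N then 0 else - moebius j.
Proof.
move=> pp j0; have p0 := prime_gt0 pp.
have pj0 : (0 < p * j)%N by rewrite muln_gt0 p0.
case: ifPn => [pj|npj].
  rewrite /moebius ifF//; apply/negbTE/allPn; exists p.
    by rewrite mem_primes pp pj0 dvdn_mulr.
  by rewrite -ltnNge lognM// logn_prime// eqxx -[1%N]/(1 + 0)%N ltn_add2l logn_gt0 mem_primes pp j0.
have pP : perm_eq (primes (p * j)) (p :: primes j).
  apply: uniq_perm; first exact: primes_uniq.
    by rewrite /= primes_uniq mem_primes (negbTE npj) !andbF.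
  by move=> q; rewrite primesM// primes_prime// !inE.
rewrite /moebius (perm_all _ pP) (perm_size pP) /= lognM// logn_prime// eqxx.
rewrite [logn p j]lognE pp j0 (negbTE npj) addn0 /=.
have -> : all (fun q => (logn q (p * j) <= 1)%N) (primes j) =
          all (fun q => (logn q j <= 1)%N) (primes j).
  apply: eq_in_all => q; rewrite mem_primes => /and3P[qp _ qj].
  rewrite lognM// (@logn_prime q p)//; case: eqP => [qpe|//].
  by move: npj; rewrite -qpe qj.
by case: ifP => _; rewrite ?oppr0// exprS mulN1r.
Qed.

(* With n = p^e m and p not dividing m, the divisors of n prime to p are those
   of m, those exactly divisible by p are p times those of m, and the others
   do not contribute. *)
Lemma sum_moebius_divisors (n : nat) : (0 < n)%N ->
  \sum_(d <- divisors n) moebius d = (n == 1)%:R.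
Proof.
move=> n0; case: eqVneq => [->|n1]; first by rewrite big_seq1.
have n_gt1 : (1 < n)%N by lia.
pose p := pdiv n; have pp : prime p := pdiv_prime n_gt1.
have pn : (p %| n)%N := pdiv_dvd n.
have [e e0 def_n] : exists2 e, (0 < e)%N & n = (p ^ e * n`_(p^'))%N.
  exists (logn p n); first by rewrite logn_gt0 mem_primes pp n0.
  by rewrite -p_part partnC.
set m := (n`_(p^'))%N in def_n.
have m0 : (0 < m)%N by apply: part_gt0.
have cpm : coprime p m.
  by apply: (@pnat_coprime p); [exact: pnat_id | exact: part_pnat].
rewrite (bigID (fun d => p %| d)%N) /= addrC -big_filter.
have -> : \sum_(i <- [seq d <- divisors n | ~~ (p %| d)%N]) moebius i =
          \sum_(i <- divisors m) moebius i.
  apply/perm_big/uniq_perm; rewrite ?filter_uniq ?divisors_uniq// => d.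
  rewrite mem_filter -!dvdn_divisors//; apply/andP/idP => [[npd]|dm].
    rewrite def_n Gauss_dvdr// coprime_sym coprimeXl//.
    by rewrite prime_coprime.
  split; last by rewrite def_n dvdn_mull.
  by rewrite -prime_coprime//; exact: coprime_dvdr dm cpm.
rewrite [X in _ + X](bigID (fun d => moebius d == 0)) /=.
rewrite [X in _ + (X + _)]big1 ?add0r; last by move=> d /andP[_ /eqP].
rewrite -[X in _ + X]big_filter.
have -> : \sum_(i <- [seq d <- divisors n | (p %| d)%N && (moebius d != 0)]) moebius i =
   \sum_(i <- [seq d <- [seq (p * j)%N | j <- divisors m] | moebius d != 0]) moebius i.
  apply/perm_big/uniq_perm; rewrite ?filter_uniq ?divisors_uniq//.
    by rewrite map_inj_uniq ?divisors_uniq// => i j /eqP; rewrite eqn_pmul2l ?prime_gt0// => /eqP.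
  move=> d; rewrite !mem_filter -dvdn_divisors//.
  have [_|md0] := eqVneq (moebius d) 0; first by rewrite andbF.
  rewrite andbT /=; apply/andP/mapP => [[/dvdnP[j jd] dn]|[j jm ->]].
    have j0 : (0 < j)%N by have := dvdn_gt0 n0 dn; rewrite jd muln_gt0 => /andP[].
    exists j; last by rewrite mulnC.
    move: md0; rewrite jd mulnC moebius_prime_mul//; case: ifPn => // npj _.
    rewrite -dvdn_divisors//; have : (j %| n)%N.
      by apply: dvdn_trans dn; rewrite jd dvdn_mulr.
    rewrite def_n Gauss_dvdr// coprime_sym coprimeXl//.
    by rewrite prime_coprime.
  rewrite dvdn_mulr//; split=> //; move: jm; rewrite -dvdn_divisors// => jm.
  by rewrite def_n -(prednK e0) expnS -mulnA dvdn_pmul2l ?prime_gt0// dvdn_mull.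
rewrite big_filter big_map [X in _ + X]big_mkcond -big_split /= big_seq big1// => j.
rewrite -dvdn_divisors// => jm; have j0 := dvdn_gt0 m0 jm.
have npj : ~~ (p %| j)%N by rewrite -prime_coprime//; exact: coprime_dvdr jm cpm.
rewrite moebius_prime_mul// (negbTE npj) oppr_eq0.
by case: eqVneq => [->|_]; rewrite ?addr0// subrr.
Qed.

Lemma sum_moebius_dvd (T n : nat) : (0 < n <= T)%N ->
  \sum_(1 <= k < T.+1 | (k %| n)%N) moebius k = (n == 1)%:R.
Proof.
move=> /andP[n0 nT]; rewrite -sum_moebius_divisors// -big_filter.
apply/perm_big/uniq_perm; rewrite ?filter_uniq ?iota_uniq ?divisors_uniq// => d.
rewrite mem_filter mem_index_iota -dvdn_divisors//; case: (boolP (d %| n)%N) => //= dn.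
by rewrite (dvdn_gt0 n0 dn) ltnS (leq_trans (dvdn_leq n0 dn)).
Qed.

Lemma big_dvdn_range (V : nmodType) (G : nat -> V) (k T : nat) : (0 < k)%N ->
  \sum_(1 <= b < T.+1 | (k %| b)%N) G b = \sum_(1 <= b < (T %/ k).+1) G (k * b)%N.
Proof.
move=> k0; elim: T => [|T IH]; first by rewrite div0n !big_geq.
rewrite big_mkcond big_nat_recr//= -big_mkcond IH divnS//.
case: ifPn => kT; last by rewrite addr0 add0n.
rewrite add1n [RHS]big_nat_recr//=; congr (_ + G _).
by move: kT => /dvdnP[q qT]; rewrite -[X in (k * X)%N]/(1 + T %/ k)%N;
   have := divnS T k0; rewrite qT dvdn_mull// mulnK// mulnC => ->.
Qed.

Section TriangularSums.
Variable R : numFieldType.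
Implicit Types (F : nat -> nat -> R) (T k : nat).

Definition tri_sum F T := \sum_(1 <= b < T.+1) \sum_(0 <= a < b.+1) F a b.

(* The pair (0, 1) is included, since coprime 0 1 holds. *)
Definition coprime_tri_sum F T :=
  \sum_(1 <= b < T.+1) \sum_(0 <= a < b.+1 | coprime a b) F a b.

Definition homogeneous0 F :=
  forall k a b, (0 < k)%N -> (0 < b)%N -> F (k * a)%N (k * b)%N = F a b.

(** The indicator of coprimality is the sum of [moebius k] over the k dividing both entries. Pairs
    divisible by k are k times the pairs of the triangle of size [T %/ k], and homogeneity gives
    them the same weights. *)
Lemma coprime_tri_sum_moebius F T : homogeneous0 F ->
  coprime_tri_sum F T =
    \sum_(1 <= k < T.+1) (moebius k)%:~R * tri_sum F (T %/ k).
Proof.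
move=> Fhom.
have row k b : (0 < k)%N -> (0 < b)%N ->
    \sum_(0 <= a < (k * b).+1 | (k %| a)%N) F a (k * b)%N =
    \sum_(0 <= a < b.+1) F a b.
  move=> k0 b0; rewrite big_mkcond big_nat_recl//= dvdn0.
  rewrite [RHS]big_nat_recl// -(Fhom k 0%N b) // muln0; congr (_ + _).
  rewrite -big_mkcond.
  have := @big_dvdn_range R (fun a => F a (k * b)%N) k (k * b) k0.
  rewrite mulKn// big_mkcond big_add1 /= -big_mkcond /= => ->.
  rewrite big_add1 /=; apply: eq_bigr => a _; exact: Fhom.
transitivity (\sum_(1 <= k < T.+1) (moebius k)%:~R *
   \sum_(1 <= b < T.+1 | (k %| b)%N) \sum_(0 <= a < b.+1 | (k %| a)%N) F a b); last first.
  apply: eq_big_nat => k /andP[k0 _]; congr (_ * _).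
  rewrite big_dvdn_range//; apply: eq_big_nat => b /andP[b0 _]; exact: row.
under [RHS]eq_bigr do rewrite big_mkcond big_distrr /=.
rewrite exchange_big /=; apply: eq_big_nat => b /andP[b0 bT].
transitivity (\sum_(1 <= k < T.+1) \sum_(0 <= a < b.+1)
    (if (k %| gcdn a b)%N then (moebius k)%:~R else 0) * F a b); last first.
  apply: eq_bigr => k _; case: (boolP (k %| b)%N) => kb.
    rewrite big_distrr /= [RHS]big_mkcond /=; apply: eq_bigr => a _.
    by rewrite dvdn_gcd kb andbT; case: ifP => _ //; rewrite mul0r.
  rewrite mulr0; apply: big1 => a _.
  by rewrite dvdn_gcd (negbTE kb) andbF mul0r.
rewrite exchange_big big_mkcond /=; apply: eq_bigr => a _.
rewrite -big_distrl -big_mkcond /= -rmorph_sum /= sum_moebius_dvd; last first.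
  by rewrite gcdn_gt0 b0 orbT /= -ltnS (leq_trans _ bT)// ltnS dvdn_leq// dvdn_gcdr.
by rewrite /coprime; case: eqP => _; rewrite ?mul1r ?mul0r.
Qed.

End TriangularSums.

(** * The value of zeta(2) *)


Section Basel.
Variable R : realType.
Implicit Types x : R.

Lemma sin_le_id x : 0 <= x -> sin x <= x.
Proof.
rewrite le_eqVlt => /predU1P[<-|x0]; first by rewrite sin0.
have [c _] := @MVT R sin cos 0 x x0 (fun y _ => is_derive_sin y)
  (continuous_subspaceT (@continuous_sin R)).
by rewrite sin0 !subr0 => ->; rewrite ler_piMl ?cos_le1// ltW.
Qed.

Lemma id_le_tan x : 0 <= x < pi / 2 -> x <= tan x.
Proof.
move=> /andP[]; rewrite le_eqVlt => /predU1P[<- _|x0 xpi]; first by rewrite tan0.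
have cpos (y : R) : 0 <= y <= x -> 0 < cos y.
  by move=> /andP[y0 yx]; apply: cos_gt0_pihalf; have := pi_gt0 R; lra.
have [||c] := @MVT R tan (fun y => (cos y) ^- 2) 0 x x0.
- move=> y; rewrite in_itv /= => /andP[y0 yx]; apply: is_derive_tan.
  by rewrite gt_eqF// cpos// !ltW.
- apply: continuous_in_subspaceT => y; rewrite inE /= in_itv /= => yx.
  by apply: continuous_tan; rewrite gt_eqF// cpos.
rewrite in_itv /= => /andP[c0 cx]; rewrite tan0 !subr0 => ->.
have cc : 0 < cos c by rewrite cpos// !ltW.
by rewrite ler_peMl ?(ltW x0)// invf_ge1 ?exprn_gt0// ?exprn_ile1 ?cos_le1 ?(ltW cc).
Qed.

Lemma invsq_sin_ge x : 0 < x < pi / 2 -> (x ^+ 2)^-1 <= (sin x ^+ 2)^-1.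
Proof.
move=> /andP[x0 xpi]; have s0 : 0 < sin x by rewrite sin_gt0_pihalf// x0.
by rewrite lef_pV2 ?posrE ?exprn_gt0// lerXn2r ?nnegrE ?(ltW s0) ?(ltW x0)// sin_le_id ?ltW.
Qed.

(** Follows from 1 / sin^2 = 1 + 1 / tan^2 and tan x >= x. *)
Lemma invsq_sin_le x : 0 < x < pi / 2 -> (sin x ^+ 2)^-1 <= 1 + (x ^+ 2)^-1.
Proof.
move=> /andP[x0 xpi]; have s0 : 0 < sin x by rewrite sin_gt0_pihalf// x0.
have c0 : 0 < cos x by apply: cos_gt0_pihalf; have := pi_gt0 R; lra.
have t0 : 0 < tan x by rewrite divr_gt0.
have -> : (sin x ^+ 2)^-1 = 1 + (tan x ^+ 2)^-1.
  rewrite /tan expr_div_n invf_div -[X in X + _](@divff _ (sin x ^+ 2)) ?expf_neq0 ?gt_eqF//.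
  by rewrite -mulrDl addrC cos2Dsin2 mul1r.
rewrite lerD2l lef_pV2 ?posrE ?exprn_gt0// lerXn2r ?nnegrE ?(ltW t0) ?(ltW x0)//.
by apply: id_le_tan; rewrite (ltW x0).
Qed.

(* 1 / sin^2 t = (1 / sin^2 (t / 2) + 1 / sin^2 (pi / 2 - t / 2)) / 4 *)
Lemma sum_invsq_sin (n : nat) :
  \sum_(0 <= k < 2 ^ n) (sin ((2 * k%:R + 1) * (pi / 2 ^+ n.+2) : R) ^+ 2)^-1 = 2 * 4 ^+ n.
Proof.
elim: n => [|n IH].
  rewrite expn0 big_nat1 mulr0 add0r mul1r expr0 mulr1.
  have t1 := tan_piquarter R; have c := cos2Dsin2 (pi / 4 : R).
  rewrite (_ : 2 ^+ 2 = 4); last by ring.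
  have c0 : cos (pi / 4 : R) != 0.
    by rewrite gt_eqF// cos_gt0_pihalf//; have := pi_gt0 R; lra.
  have sc : sin (pi / 4 : R) = cos (pi / 4).
    by move: t1; rewrite /tan => /(congr1 ( *%R^~ (cos (pi / 4)))); rewrite divfK// mul1r.
  have -> : sin (pi / 4 : R) ^+ 2 = 1 / 2 by move: c; rewrite -sc; lra.
  by field.
rewrite expnS mul2n -addnn (big_cat_nat (leq0n _) (leq_addr _ _)) /=.
(* Reversing the second half of the range makes its k-th angle pi / 2 - t, the partner of t in the
   half-angle identity. *)
rewrite -{2}[(2 ^ n)%N]add0n big_addn addnK [X in _ + X]big_nat_rev -big_split /=.
rewrite (_ : 2 * 4 ^+ n.+1 = (2 * 4 ^+ n) * 4); last by rewrite exprSr mulrA.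
rewrite -IH big_distrl /=; apply: eq_big_nat => k /andP[_ k2].
have h : 0 < (2 : R) ^+ n by rewrite exprn_gt0.
have kr : k%:R + 1 <= (2 : R) ^+ n by rewrite natr1 -natrX ler_nat.
have k0 : 0 <= k%:R :> R by [].
set t := (2 * k%:R + 1) * (pi / 2 ^+ n.+3).
have -> : (2 * k%:R + 1) * (pi / 2 ^+ n.+2) = t *+ 2.
  by rewrite /t mulr2n !exprS; field; rewrite gt_eqF.
have -> : (2 * (0 + 2 ^ n - k.+1 + 2 ^ n)%:R + 1) * (pi / 2 ^+ n.+3) = pi / 2 - t.
  rewrite add0n natrD natrB// -natr1 natrX /t !exprS; field.
  by rewrite gt_eqF.
rewrite sinB sin_pihalf cos_pihalf mul0r subr0 mul1r sin_mulr2n.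
have pp := pi_gt0 R.
have tb : 0 < t < pi / 2.
  rewrite /t mulr_gt0 ?divr_gt0//; try lra.
  rewrite mulrA ltr_pdivrMr//.
  rewrite (_ : pi / 2 * 2 ^+ n.+3 = (4 * 2 ^+ n) * pi); last by rewrite !exprS; field.
  by rewrite ltr_pM2r//; lra.
have s0 : sin t != 0 by rewrite gt_eqF// sin_gt0_pihalf.
have c0 : cos t != 0 by rewrite gt_eqF// cos_gt0_pihalf//; lra.
transitivity ((cos t ^+ 2 + sin t ^+ 2) / (sin t * cos t) ^+ 2).
  by field; apply/andP.
rewrite cos2Dsin2 -mulr_natr; field; exact/andP.
Qed.

(** At the angles of [sum_invsq_sin], 1 / sin^2 lies between 1 / x^2 and 1 + 1 / x^2. Scaling by
    u^2, where u = pi / 2 ^ (n + 2), turns the total 2 * 4 ^ n into pi^2 / 8 and the 2 ^ n extra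
    units into pi^2 / 16 / 2 ^ n. *)
Lemma sum_odd_invsq_bounds (n : nat) :
  pi ^+ 2 / 8 - pi ^+ 2 / 16 / 2 ^+ n <=
  \sum_(0 <= k < 2 ^ n) ((2 * k%:R + 1 : R) ^+ 2)^-1 <= pi ^+ 2 / 8.
Proof.
have pp := pi_gt0 R; have h : 0 < (2 : R) ^+ n by rewrite exprn_gt0.
set u : R := pi / 2 ^+ n.+2; have u0 : 0 < u by rewrite divr_gt0.
have tb k : (0 <= k < 2 ^ n)%N -> 0 < (2 * k%:R + 1) * u < pi / 2.
  move=> /= k2; have kr : k%:R + 1 <= (2 : R) ^+ n by rewrite natr1 -natrX ler_nat.
  have k0 : 0 <= k%:R :> R by [].
  have -> /= : 0 < (2 * k%:R + 1) * u by rewrite mulr_gt0//; lra.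
  rewrite (_ : pi / 2 = (2 * 2 ^+ n) * u); last first.
    by rewrite /u !exprS; field; rewrite gt_eqF.
  by rewrite ltr_pM2r//; lra.
have lo : \sum_(0 <= k < 2 ^ n) ((2 * k%:R + 1 : R) ^+ 2)^-1 / u ^+ 2 <= 2 * 4 ^+ n.
  rewrite -sum_invsq_sin; apply: ler_sum_nat => k /tb /invsq_sin_ge.
  by rewrite exprMn invfM.
have up : 2 * 4 ^+ n <= 2 ^+ n + \sum_(0 <= k < 2 ^ n) ((2 * k%:R + 1 : R) ^+ 2)^-1 / u ^+ 2.
  rewrite -sum_invsq_sin.
  have -> : (2 : R) ^+ n = \sum_(0 <= k < 2 ^ n) 1.
    by rewrite sumr_const_nat subn0 -natrX.
  rewrite -big_split /=; apply: ler_sum_nat => k /tb /invsq_sin_le.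
  by rewrite (exprMn _ (2 * _ + 1)) [in leRHS]invfM.
move: lo up; rewrite -big_distrl /=; set S := \sum_(_ <= _ < _) _.
have e4 : (4 : R) ^+ n = 2 ^+ n * 2 ^+ n by rewrite -expr2 exprAC; congr (_ ^+ _); ring.
have -> : (u ^+ 2)^-1 = 16 * (2 ^+ n * 2 ^+ n) / pi ^+ 2.
  have aux (p w : R) : p != 0 -> w != 0 -> ((p / (4 * w)) ^+ 2)^-1 = 16 * (w * w) / p ^+ 2.
    by move=> p0 w0; field; apply/andP.
  rewrite /u (_ : 2 ^+ n.+2 = 4 * 2 ^+ n) ?aux ?gt_eqF//.
  by rewrite !exprS; ring.
rewrite e4; set w := 2 ^+ n in h *; set q := pi ^+ 2.
have q0 : 0 < q by rewrite exprn_gt0.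
rewrite [S * _]mulrA ler_pdivrMr// -lerBlDl ler_pdivlMr// => lo up.
have w2 : 0 < w * w by rewrite mulr_gt0.
clearbody q.
apply/andP; split.
  rewrite -(ler_pM2r w2) (_ : (q / 8 - _) * _ = (2 * (w * w) - w) * q / 16); last first.
    by field; rewrite gt_eqF.
  lra.
rewrite -(ler_pM2r w2); lra.
Qed.

Definition zeta2_sum (n : nat) : R := \sum_(1 <= k < n.+1) (k%:R ^+ 2)^-1.

Lemma zeta2_sum_double n :
  zeta2_sum (2 * n) = \sum_(0 <= k < n) ((2 * k%:R + 1 : R) ^+ 2)^-1 + zeta2_sum n / 4.
Proof.
rewrite /zeta2_sum; elim: n => [|n IH]; first by rewrite !big_geq// mul0r addr0.
rewrite (_ : (2 * n.+1) = (2 * n).+2)%N; last by rewrite mulnS.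
rewrite 2?big_nat_recr//= IH 2?[in RHS]big_nat_recr//=.
rewrite -!natr1 natrM; have n0 : 0 <= n%:R :> R by [].
by field; apply/and3P; split; apply: lt0r_neq0; lra.
Qed.

Lemma zeta2_sum_le m n : (m <= n)%N -> zeta2_sum m <= zeta2_sum n.
Proof.
move=> mn; rewrite /zeta2_sum (@big_cat_nat _ _ _ m.+1 1 n.+1)//= lerDl.
by apply: sumr_ge0 => k _; rewrite invr_ge0 exprn_ge0.
Qed.

(** Telescoping of 1 / (n + 1)^2 <= 1 / n - 1 / (n + 1). *)
Lemma zeta2_sum_tail m n : (0 < m <= n)%N ->
  zeta2_sum n - zeta2_sum m <= m%:R^-1 - n%:R^-1.
Proof.
move=> /andP[m0]; elim: n => [|n IH]; first by case: m m0.
rewrite leq_eqVlt => /predU1P[->|]; first by rewrite !subrr.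
rewrite ltnS => mn; have {}IH := IH mn.
have n0 : 0 < n%:R :> R by rewrite ltr0n (leq_trans m0).
rewrite {1}/zeta2_sum big_nat_recr//= -/(zeta2_sum n).
suff : (n.+1%:R ^+ 2)^-1 <= n%:R^-1 - n.+1%:R^-1 :> R.
  move: IH; set z := zeta2_sum n; set y := zeta2_sum m; set u := _ ^- 2.
  set w := n.+1%:R^-1; clearbody z y u w; lra.
rewrite -natr1 -subr_ge0 (_ : _ - _ = (n%:R * (n%:R + 1) ^+ 2)^-1); last first.
  by field; apply/andP; split; apply: lt0r_neq0; lra.
by rewrite invr_ge0 mulr_ge0 ?exprn_ge0//; lra.
Qed.

(* Iterating zeta2_sum_double, the defect e_n satisfies e_(n+1) <= 2^-n + e_n / 4. *)
Lemma zeta2_sum_pow2_bounds n :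
  0 <= pi ^+ 2 / 6 - zeta2_sum (2 ^ n) <= 4 / 2 ^+ n.
Proof.
have q16 : pi ^+ 2 <= 16 :> R.
  by have := @pihalf_lt2 R; have := pi_gt0 R; nra.
elim: n => [|n IH].
  have := sum_odd_invsq_bounds 0.
  rewrite expn0 big_nat1 mulr0 add0r expr1n /zeta2_sum big_nat1 expr1n expr0 !invr1; lra.
have /andP[] := sum_odd_invsq_bounds n.
rewrite expnS zeta2_sum_double; set S := \sum_(_ <= _ < _) _.
have h : 0 < (2 : R) ^- n by rewrite invr_gt0 exprn_gt0.
move: IH; rewrite (exprS _ n) invfM; set w := 2 ^- n in h *.
by move=> /andP[a b] c d; nra.
Qed.

(** Since n < 2 ^ n, the bound 4 / 2 ^ n is at most 4 / (n + 1), and the tail between n and 2 ^ n is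
    at most 1 / n <= 2 / (n + 1). The denominator n + 1 suits the later use at n = [T %/ k], where n
    + 1 >= T / k. *)
Lemma zeta2_sum_bounds n : `|pi ^+ 2 / 6 - zeta2_sum n| <= 6 / n.+1%:R.
Proof.
have /andP[a b] := zeta2_sum_pow2_bounds n.
have nn : (n < 2 ^ n)%N by apply: ltn_expl.
have c := zeta2_sum_le _ _ (ltnW nn).
rewrite ger0_norm; last by lra.
have d : 4 / 2 ^+ n <= 4 / n.+1%:R :> R.
  by rewrite ler_pM2l// lef_pV2 ?posrE ?exprn_gt0 ?ltr0n// -natrX ler_nat.
case: (posnP n) b c d nn a => [->|n0] b c d nn a.
  have q16 : pi ^+ 2 <= 16 :> R.
    by have := @pihalf_lt2 R; have := pi_gt0 R; nra.
  rewrite /zeta2_sum big_geq//; lra.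
have n0r : 1 <= n%:R :> R by rewrite ler1n.
have := @zeta2_sum_tail n (2 ^ n); rewrite n0 ltnW//= => /(_ isT) t.
have p0 : 0 <= (2 ^ n)%:R^-1 :> R by rewrite invr_ge0.
have : n%:R^-1 <= 2 / n.+1%:R :> R.
  by rewrite ler_pdivlMr ?ltr0n// mulrC ler_pdivrMr -?natr1; lra.
move: b d t p0; set u := n.+1%:R^-1; set v := 2 ^- n; set w := (2 ^ n)%:R^-1.
by set z := zeta2_sum n; set y := zeta2_sum _; set x := n%:R^-1; clearbody u v w x y z; lra.
Qed.

End Basel.

(** * Decimals of pi *)


Section SinPi.
Variable R : realType.
Implicit Types x : R.

(** The triple-angle formula at sin (pi / 2) = 1 factors as (s + 1) (2 s - 1)^2 = 0, and s > 0. *)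
Lemma sin_pi6 : sin (pi / 6 : R) = 1 / 2.
Proof.
have p0 := pi_gt0 R.
have s0 : 0 < sin (pi / 6 : R) by apply: sin_gt0_pi; lra.
have : sin (pi / 2 : R) = 1 := sin_pihalf R.
have -> : pi / 2 = pi / 6 *+ 2 + pi / 6 :> R by field.
rewrite sinD sin_mulr2n cos_mulr2n mulr2n => E.
have := cos2Dsin2 (pi / 6 : R); move: E s0.
set s := sin _; set c := cos _ => E s0 cs.
have {}E : (s + 1) * (2 * s - 1) ^+ 2 = 0.
  have c2 : c ^+ 2 = 1 - s ^+ 2 by rewrite -cs addrK.
  have {}E : 4 * c ^+ 2 * s - s = 1 by rewrite -[RHS]E; ring.
  transitivity (1 - (4 * (1 - s ^+ 2) * s - s)); first by ring.
  by rewrite -c2 E subrr.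
move/eqP: E; rewrite mulf_eq0 expf_eq0 /= => /orP[] /eqP; lra.
Qed.

Definition sin_term x (i : nat) := (-1) ^+ i * x ^+ i.*2.+1 / i.*2.+1`!%:R.

(** This ratio of successive terms lets partial sums unfold into Horner form, where only small
    denominators occur. *)
Lemma sin_termS x i :
  sin_term x i.+1 = - (sin_term x i * (x ^+ 2 / ((2 * i%:R + 3) * (2 * i%:R + 2)))).
Proof.
have h : 0 <= i%:R :> R by [].
have E3 : i.*2.+3%:R = 2 * i%:R + 3 :> R by rewrite -addn3 natrD -mul2n natrM.
have E2 : i.*2.+2%:R = 2 * i%:R + 2 :> R by rewrite -addn2 natrD -mul2n natrM.
rewrite /sin_term doubleS !(factS i.*2.+2, factS i.*2.+1) !natrM E3 E2 exprS -(addn2 i.*2.+1) exprD.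
field; apply/and3P; split; rewrite ?pnatr_eq0 -?lt0n ?fact_gt0//; apply: lt0r_neq0; lra.
Qed.

Lemma sin_term0 x : sin_term x 0 = x.
Proof. by rewrite /sin_term expr0 expr1 mul1r divr1. Qed.

Lemma sin_coeff_pair_gt0 x n : 0 < x < 1 ->
  0 < x ^+ n.*2.+1 / n.*2.+1`!%:R - x ^+ n.*2.+3 / n.*2.+3`!%:R.
Proof.
move=> /andP[x0 x1]; rewrite subr_gt0 ltr_pM ?exprn_ge0 ?invr_ge0 ?ltW//.
  by rewrite ltr_iXn2l.
by rewrite ltf_pV2 ?posrE ?ltr0n ?fact_gt0// ltr_nat ltn_pfact.
Qed.

(** After an even number of terms the rest of the alternating series groups into pairs of positive
    sum. *)
Lemma sin_gt_partial_sum x m : 0 < x < 1 ->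
  \sum_(0 <= i < m.*2) sin_term x i < sin x.
Proof.
move=> x01; have h := @cvg_sin_coeff' R x; rewrite -(cvg_lim (@Rhausdorff R) h).
apply: lt_sum_lim_series; first by apply/cvg_ex; exists (sin x).
move=> d; rewrite /sin_term /sin_coeff' addnS.
have := @sin_coeff_pair_gt0 x (m.*2 + d.*2) x01.
have s1 : (-1) ^+ (m.*2 + d.*2) = 1 :> R by rewrite -doubleD -signr_odd odd_double.
by rewrite (exprS (-1)) s1 mulr1 mul1r mulN1r mulNr.
Qed.

(** After an odd number of terms the remaining pairs are negative, so the same criterion is applied
    to the negated series. *)
Lemma sin_lt_partial_sum x m : 0 < x < 1 ->
  sin x < \sum_(0 <= i < m.*2.+1) sin_term x i.
Proof.
move=> x01; rewrite -ltrN2 -sumrN; have /cvgN h := @cvg_sin_coeff' R x.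
rewrite -(cvg_lim (@Rhausdorff R) h) -seriesN.
apply: (@lt_sum_lim_series _ (- sin_coeff' x)).
  by rewrite seriesN; apply/cvg_ex; exists (- sin x).
have N k : (- sin_coeff' x) k = - sin_coeff' x k by [].
move=> d; rewrite !N /sin_coeff' addnS.
have := @sin_coeff_pair_gt0 x (m.*2.+1 + d.*2) x01.
have s1 : (-1) ^+ (m.*2.+1 + d.*2) = -1 :> R.
  by rewrite addSn -doubleD -signr_odd /= odd_double.
have s2 : (-1) ^+ (m.*2.+1 + d.*2).+1 = 1 :> R by rewrite exprS s1 mulrNN mulr1.
by rewrite -!exprnP s1 s2 mul1r mulN1r mulNr opprK.
Qed.

Lemma sin_partial_sum6 x :
  \sum_(0 <= i < 3.*2) sin_term x i =
  x * (1 - x ^+ 2 / 6 * (1 - x ^+ 2 / 20 * (1 - x ^+ 2 / 42 *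
    (1 - x ^+ 2 / 72 * (1 - x ^+ 2 / 110))))).
Proof. by rewrite unlock /= !sin_termS sin_term0; field. Qed.

Lemma sin_partial_sum7 x :
  \sum_(0 <= i < 3.*2.+1) sin_term x i =
  x * (1 - x ^+ 2 / 6 * (1 - x ^+ 2 / 20 * (1 - x ^+ 2 / 42 *
    (1 - x ^+ 2 / 72 * (1 - x ^+ 2 / 110 * (1 - x ^+ 2 / 156)))))).
Proof. by rewrite unlock /= !sin_termS sin_term0; field. Qed.

(* The sine is increasing, so pi / 6 is compared with a rational q by comparing
   1 / 2 with alternating Taylor sums at q. *)
Lemma pi_bounds : 3 + 1415 / 10 ^+ 4 + 9265 / 10 ^+ 8 + 358 / 10 ^+ 11 < (pi : R) < 3 + 1415 / 10 ^+ 4 + 9265 / 10 ^+ 8 + 36 / 10 ^+ 10.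
Proof.
have p2 := pi_ge2 R; have p4 : (pi : R) < 4 by have := @pihalf_lt2 R; lra.
have mono (x y : R) : x < 1 -> y < 1 -> 0 < x -> 0 < y -> sin x < sin y -> x < y.
  move=> *; rewrite -ltr_sin// in_itv /=; lra.
have ub (q : R) : 0 < q < 1 -> sin q < 1/2 -> q < pi / 6.
  move=> /andP[q0 q1]; rewrite -sin_pi6; apply: mono; lra.
have lb (q : R) : 0 < q < 1 -> 1/2 < sin q -> pi / 6 < q.
  move=> /andP[q0 q1]; rewrite -sin_pi6; apply: mono; lra.
have l : (3 + 1415 / 10 ^+ 4 + 9265 / 10 ^+ 8 + 358 / 10 ^+ 11) / 6 < (pi : R) / 6.
  apply: ub; first lra.
  by apply: lt_trans (@sin_lt_partial_sum _ 3 _) _; [lra | rewrite sin_partial_sum7; lra].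
have u : (pi : R) / 6 < (3 + 1415 / 10 ^+ 4 + 9265 / 10 ^+ 8 + 36 / 10 ^+ 10) / 6.
  apply: lb; first lra.
  by apply: lt_trans (@sin_gt_partial_sum _ 3 _); [rewrite sin_partial_sum6; lra | lra].
lra.
Qed.
End SinPi.

(** * Counting coprime pairs *)


Section CoprimeCounting.
Variable R : realType.

Definition harmonic_sum (T : nat) : R := \sum_(1 <= k < T.+1) k%:R^-1.

Lemma harmonic_sum_ge0 T : 0 <= harmonic_sum T.
Proof. by apply: sumr_ge0 => k _; rewrite invr_ge0. Qed.

Lemma harmonic_sum_le_ln T : (0 < T)%N -> harmonic_sum T <= 1 + ln T%:R.
Proof.
elim: T => // -[|T] IH _; first by rewrite /harmonic_sum big_nat1 invr1 ln1 addr0.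
rewrite /harmonic_sum big_nat_recr//= -/(harmonic_sum T.+1).
have {}IH := IH isT.
(* The increment comes from ln (1 - 1 / (T + 2)) <= - 1 / (T + 2). *)
suff : T.+2%:R^-1 <= ln T.+2%:R - ln T.+1%:R :> R.
  move: IH; set a := harmonic_sum _; set b := _^-1; set c := ln _; set d := ln _.
  by clearbody a b c d; lra.
have h1 : 0 < T.+1%:R :> R by rewrite ltr0n.
have h2 : 0 < T.+2%:R :> R by rewrite ltr0n.
rewrite -opprB -ln_div ?posrE// lerNr.
have -> : T.+1%:R / T.+2%:R = 1 + - T.+2%:R^-1 :> R.
  by rewrite -[T.+1%:R](addrK 1) natr1 mulrBl divff ?gt_eqF// mul1r.
apply: le_ln1Dx; rewrite ltrN2 invf_lt1// ltr1n//.
Qed.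

Lemma divn_approx (T k : nat) : (0 < k)%N ->
  (T %/ k)%:R <= T%:R / k%:R :> R /\ T%:R / k%:R <= (T %/ k)%:R + 1 :> R.
Proof.
move=> k0; have kr : 0 < k%:R :> R by rewrite ltr0n.
split; first by rewrite ler_pdivlMr// -natrM ler_nat leq_trunc_div.
by rewrite ler_pdivrMr// natr1 -natrM ler_nat ltnW// ltn_ceil.
Qed.

Lemma norm_moebiusr k : `|(moebius k)%:~R : R| <= 1.
Proof. by rewrite -intr_norm -[leRHS]/(1%:~R) ler_int norm_moebius. Qed.

Definition moebius2_sum (T : nat) : R :=
  \sum_(1 <= k < T.+1) (moebius k)%:~R / k%:R ^+ 2.

(** A finite form of zeta(2) times the sum of mu(k) / k^2 being 1: the pairs (k, j) with k j <= T
    are grouped by n = k j, and only n = 1 survives. *)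
Lemma moebius2_convolution T : (0 < T)%N ->
  \sum_(1 <= k < T.+1) (moebius k)%:~R / k%:R ^+ 2 * zeta2_sum R (T %/ k) = 1.
Proof.
move=> T0.
transitivity (\sum_(1 <= k < T.+1) \sum_(1 <= n < T.+1 | (k %| n)%N)
   (moebius k)%:~R * (n%:R ^+ 2)^-1 : R).
  apply: eq_big_nat => k /andP[k0 _]; rewrite big_dvdn_range// -mulrA -big_distrr /=.
  congr (_ * _); rewrite /zeta2_sum big_distrr /=; apply: eq_bigr => j _.
  by rewrite -invfM -exprMn -natrM.
under eq_bigr do rewrite big_mkcond.
rewrite exchange_big /=.
transitivity (\sum_(1 <= n < T.+1) (n == 1)%:R * (n%:R ^+ 2)^-1 : R).
  apply: eq_big_nat => n nT; rewrite -big_mkcond -big_distrl /= -rmorph_sum /=.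
  by rewrite sum_moebius_dvd//; case: eqP.
rewrite big_ltn ?ltnS// eqxx mul1r expr1n invr1 big_nat big1 ?addr0// => n /andP[n1 _].
by rewrite gtn_eqF// mul0r.
Qed.

(* Compare zeta(2) with the truncations zeta2_sum (T %/ k) in moebius2_convolution. *)
Lemma moebius2_sum_bound T : (0 < T)%N ->
  `|pi ^+ 2 / 6 * moebius2_sum T - 1| <= 6 * (harmonic_sum T / T%:R).
Proof.
move=> T0; have Tr : 0 < T%:R :> R by rewrite ltr0n.
rewrite -[X in _ - X](moebius2_convolution _ T0) /moebius2_sum mulrC big_distrl /= -sumrB.
rewrite /harmonic_sum mulrA [_ * \sum_(_ <= _ < _) _]big_distrr big_distrl /=.
apply: le_trans (ler_norm_sum _ _ _) _.
apply: ler_sum_nat => k /andP[k0 kT]; have kr : 0 < k%:R :> R by rewrite ltr0n.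
rewrite -mulrBr normrM normf_div.
have h := zeta2_sum_bounds R (T %/ k).
have [_ h2] := divn_approx T _ k0.
apply: (@le_trans _ _ ((1 / k%:R ^+ 2) * (6 / (T %/ k).+1%:R))).
  rewrite ler_pM ?mulr_ge0 ?invr_ge0//.
  by rewrite ler_pM ?norm_moebiusr ?invr_ge0// ger0_norm// exprn_ge0.
(* Combined with the factor 1 / k^2, this bounds the k-th term by 6 / (k T). *)
have h3 : (T %/ k).+1%:R^-1 <= k%:R / T%:R :> R.
  by rewrite -[leRHS]invf_div lef_pV2 ?posrE ?ltr0n ?divr_gt0// -natr1.
apply: le_trans (ler_wpM2l _ (ler_wpM2l _ h3)) _ => //.
by rewrite le_eqVlt; apply/orP; left; apply/eqP; field; rewrite !gt_eqF.
Qed.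

(** With M = [T %/ k], replacing the triangle sum at M by al (T / k)^2 costs K T / k for the
    hypothesis and 2 |al| T / k for the rounding. Replacing the truncated Moebius sum by 6 / pi^2
    costs |al| (36 / pi^2) T H, with H the harmonic sum, which is at most 9 |al| T H because pi >=
    2. Hence 11 = 2 + 9. *)
Lemma coprime_tri_sum_asymptotic (F : nat -> nat -> R) (al K : R) (T : nat) :
  homogeneous0 R F ->
  (forall M, `|tri_sum R F M - al * M%:R ^+ 2| <= K * M%:R) -> (0 < T)%N ->
  `|coprime_tri_sum R F T - al * (6 / pi ^+ 2) * T%:R ^+ 2|
     <= (K + 11 * `|al|) * (T%:R * (1 + ln T%:R)).
Proof.
move=> Fhom FK T0; have Tr : 0 < T%:R :> R by rewrite ltr0n.
have H0 := harmonic_sum_ge0 T.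
have K0 : 0 <= K by have := FK 1%N; rewrite mulr1; apply: le_trans.
have q0 : 0 < pi ^+ 2 :> R by rewrite exprn_gt0// pi_gt0.
have q4 : 4 <= pi ^+ 2 :> R by have := pi_ge2 R; nra.
apply: (@le_trans _ _ ((K + 11 * `|al|) * (T%:R * harmonic_sum T))); last first.
  by rewrite ler_wpM2l ?addr_ge0 ?mulr_ge0// ler_wpM2l// harmonic_sum_le_ln.
rewrite (_ : _ - _ = (coprime_tri_sum R F T - al * T%:R ^+ 2 * moebius2_sum T)
   + al * T%:R ^+ 2 * (6 / pi ^+ 2) * (pi ^+ 2 / 6 * moebius2_sum T - 1)); last first.
  by move: (pi ^+ 2) q0 {q4} => q q0; field; rewrite gt_eqF.
apply: le_trans (ler_normD _ _) _.
have -> : (K + 11 * `|al|) * (T%:R * harmonic_sum T) =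
   (K + 2 * `|al|) * (T%:R * harmonic_sum T) + 9 * `|al| * (T%:R * harmonic_sum T).
  by ring.
apply: lerD.
- rewrite coprime_tri_sum_moebius// /moebius2_sum big_distrr -sumrB /=.
  rewrite /harmonic_sum !big_distrr /=.
  apply: le_trans (ler_norm_sum _ _ _) _.
  apply: ler_sum_nat => k /andP[k0 kT]; have kr : 0 < k%:R :> R by rewrite ltr0n.
  have [h1 h2] := divn_approx T _ k0.
  set M := (T %/ k)%N in h1 h2 *.
  rewrite (_ : _ - _ = (moebius k)%:~R * (tri_sum R F M - al * (T%:R / k%:R) ^+ 2)); last first.
    by field; rewrite gt_eqF.
  rewrite normrM; apply: le_trans (ler_wpM2r (normr_ge0 _) (norm_moebiusr k)) _.
  rewrite mul1r.
  rewrite (_ : _ - _ = (tri_sum R F M - al * M%:R ^+ 2) +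
      al * (M%:R ^+ 2 - (T%:R / k%:R) ^+ 2)); last by ring.
  apply: le_trans (ler_normD _ _) _; rewrite mulrDl lerD//.
    by apply: le_trans (FK M) _; rewrite ler_wpM2l.
  rewrite normrM -mulrA mulrCA ler_wpM2l//.
  have M0 : 0 <= M%:R :> R by [].
  set t := T%:R / k%:R in h1 h2 *; rewrite distrC ger0_norm ?subr_ge0 ?lerXn2r ?nnegrE//; last lra.
  by nra.
- rewrite normrM [ `|al * _ * _|]normrM [ `|al * _|]normrM [ `|6 / _|]ger0_norm ?divr_ge0 ?(ltW q0)// [ `|T%:R ^+ 2|]ger0_norm ?exprn_ge0//.
  have h := moebius2_sum_bound _ T0.
  apply: le_trans (ler_wpM2l _ h) _; first by rewrite mulr_ge0 ?divr_ge0 ?(ltW q0)// mulr_ge0// exprn_ge0.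
  rewrite [leLHS](_ : _ = 9 * `|al| * (T%:R * harmonic_sum T) * (4 / pi ^+ 2)); last first.
    by move: (pi ^+ 2) q0 {q4 h} => q q0; field; rewrite !gt_eqF.
  by rewrite ler_piMr ?mulr_ge0// ler_pdivrMr// mul1r.
Qed.
End CoprimeCounting.

(** * Geometry of the lattices *)


Section LatticeGeometry.
Variable R : realType.
Implicit Types (tau : R[i]) (v : 'cV[R]_2).

Lemma LambdaP tau v : Lambda tau v <->
  exists m n : int, v 0 0 = m%:~R + n%:~R * complex.Re tau /\ v 1 0 = n%:~R * complex.Im tau.
Proof.
split=> [[z _ <-]|[m [n [v0 v1]]]].
  exists (z 0 0), (z 1 0); rewrite !mxE !big_ord_recl !big_ord0 !mxE /=.
  have -> : lift ord0 ord0 = 1 :> 'I_2 by apply/val_inj.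
  by rewrite !addr0 mul1r mul0r add0r mulrC [in X in _ /\ X]mulrC.
exists (\col_i if i == 0 then m else n) => //.
apply/colP => i; rewrite !mxE !big_ord_recl !big_ord0 !mxE /=.
have [->|->] : i = 0 \/ i = 1.
  by case: i => [[|[|//]]] h; [left|right]; apply/val_inj.
- by rewrite v0 /= addr0 mul1r mulrC.
- by rewrite v1 /= addr0 mul0r add0r mulrC.
Qed.

Definition colv (a b : R) : 'cV[R]_2 := \col_i if i == 0 then a else b.

Lemma colv0 a b : colv a b 0 0 = a. Proof. by rewrite mxE. Qed.
Lemma colv1 a b : colv a b 1 0 = b. Proof. by rewrite mxE. Qed.
Lemma colvK v : colv (v 0 0) (v 1 0) = v.
Proof.
apply/colP => i; rewrite !mxE.
by case: i => [[|[|//]]] h; congr (v _ _); apply/val_inj.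
Qed.

Lemma enorm_colv a b : enorm (colv a b) = Num.sqrt (a ^+ 2 + b ^+ 2).
Proof.
by rewrite /enorm !big_ord_recl big_ord0 addr0 !mxE.
Qed.

Lemma Lambda_colv tau m n :
  Lambda tau (colv (m%:~R + n%:~R * complex.Re tau) (n%:~R * complex.Im tau)).
Proof. by apply/LambdaP; exists m, n; rewrite colv0 colv1. Qed.

(* The second coordinates of each lattice are the multiples of its y, whence equal
   heights; then x - x' is an integer in ]-1, 1[. *)
Lemma Lambda_inj tau tau' :
  0 < complex.Im tau -> 0 <= complex.Re tau <= 1 / 2 ->
  0 < complex.Im tau' -> 0 <= complex.Re tau' <= 1 / 2 ->
  Lambda tau = Lambda tau' -> tau = tau'.
Proof.
case: tau => x y; case: tau' => x' y' /= y0 xb y'0 x'b LL.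
have := Lambda_colv (x +i* y)%C 0 1; rewrite LL => /LambdaP[m [n]].
have := Lambda_colv (x' +i* y')%C 0 1; rewrite -LL => /LambdaP[m' [n']].
rewrite !colv0 !colv1 /= !mul1r !add0r => -[E1 E2] [E3 E4].
have n0 : 0 < n by rewrite -(ltr0z R) -(pmulr_lgt0 _ y'0) -E4.
have n'0 : 0 < n' by rewrite -(ltr0z R) -(pmulr_lgt0 _ y0) -E2.
have nn : n * n' = 1.
  have : (n * n')%:~R * y = y by rewrite intrM -mulrA -E2 -E4.
  rewrite -[RHS]mul1r => /(mulIf (lt0r_neq0 y0)) /eqP.
  by rewrite -[1]/(1%:~R) eqr_int => /eqP.
have n1 : n = 1 by nia.
move: E3 E4; rewrite n1 !mul1r => E3 ->; congr (_ +i* _)%C.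
suff m0 : m = 0 by rewrite E3 m0 add0r.
have h : -1 < (m%:~R : R) < 1 by lra.
by move: h; rewrite -[1]/(1%:~R) -mulrNz ltr_int ltr_int; lia.
Qed.

(** A subspace of least dimension among those containing S: meeting it with any other such subspace
    cannot lower the dimension. This supplies the subspace that [succ_min] asks for. *)
Lemma is_span_exists (S : set 'cV[R]_2) : exists U, is_span S U.
Proof.
pose P n := `[< exists U : {vspace 'cV[R]_2}, (forall v, S v -> v \in U) /\ \dim U = n >].
have exP : exists n, P n.
  by exists (\dim {:'cV[R]_2}); apply/asboolP; exists fullv; split=> // v _; rewrite memvf.
case: (ex_minnP exP) => n /asboolP[U [SU dU]] minU.
exists U; split=> // W SW; apply/capv_idPl/eqP.
rewrite eqEdim capvSl /= dU; apply: minU; apply/asboolP; exists (U :&: W)%VS; split=> //.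
by move=> v Sv; rewrite memv_cap SU ?SW.
Qed.

Lemma lattice_of_sub (A B : 'M[R]_2) : lattice_of A `<=` lattice_of B ->
  exists U : 'M[int]_2, A = B *m map_mx intr U.
Proof.
move=> AB; have colA j : exists z : 'cV[int]_2, B *m map_mx intr z = col j A.
  have [|z _ zE] := AB (col j A); last by exists z.
  by exists (delta_mx j 0) => //; rewrite map_delta_mx -colE.
have [f fE] := choice colA.
exists (\matrix_(i, j) f j i 0); apply/matrixP => i j.
have := congr1 (fun v : 'cV[R]_2 => v i 0) (fE j); rewrite !mxE => <-.
by apply: eq_bigr => k _; rewrite !mxE.
Qed.

(** [semi_stable] only provides some basis, so the covolume must be compared with that of
    [Lambda_mx]. The two changes of basis are integral and their determinants multiply to 1. *)
Lemma norm_det_basis (A B : 'M[R]_2) (L : set 'cV[R]_2) :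
  is_basis A L -> is_basis B L -> `|\det A| = `|\det B|.
Proof.
move=> [Au LA] [Bu LB].
have [U AU] : exists U : 'M[int]_2, A = B *m map_mx intr U.
  by apply: lattice_of_sub; rewrite -LA -LB.
have [V BV] : exists V : 'M[int]_2, B = A *m map_mx intr V.
  by apply: lattice_of_sub; rewrite -LA -LB.
have dA : \det A = \det B * (\det U)%:~R by rewrite {1}AU det_mulmx det_map_mx.
have dB : \det B = \det A * (\det V)%:~R by rewrite {1}BV det_mulmx det_map_mx.
have A0 : \det A != 0 by rewrite -unitfE -unitmxE.
have UV : \det V * \det U = 1.
  have : \det A * (\det V * \det U)%:~R = \det A * 1.
    by rewrite intrM mulrA -dB -dA mulr1.
  move=> /(mulfI A0) /eqP; rewrite -[X in _ == X]/(1%:~R) eqr_int => /eqP //.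
rewrite dA normrM -intr_norm.
have -> : `|\det U| = 1 
  by move/(congr1 absz)/eqP: UV; rewrite abszM muln_eq1 => /andP[_ /eqP u1]; rewrite -abszE u1.
by rewrite mulr1.
Qed.

Lemma inf_attained (A : set R) a : A a -> (forall r, A r -> a <= r) -> inf A = a.
Proof.
move=> Aa lbA; apply/le_anti/andP; split; first by apply: ge_inf => //; exists a.
by apply: lb_le_inf => //; exists a.
Qed.

(** * Successive minima of the lattices of the fundamental domain *)

Section Minima.
Variables (x y : R).
Hypotheses (y0 : 0 < y) (xb : 0 <= x <= 1 / 2) (xy : 1 <= x ^+ 2 + y ^+ 2).
Let tau := (x +i* y)%C.

(** As 0 <= 2 x <= 1, the difference of the two sides is at least (m^2 - |m n| + n^2 - 1) + (n^2 -
    1) (x^2 + y^2 - 1), and both summands are nonnegative. *)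
Lemma sqr_norm_Lambda_ge (m n : int) : n != 0 ->
  x ^+ 2 + y ^+ 2 <= (m%:~R + n%:~R * x) ^+ 2 + (n%:~R * y) ^+ 2.
Proof.
move=> n0.
have n2 : 1 <= n ^+ 2 by rewrite -gtz0_ge1 exprn_even_gt0.
have h : (0 : R) <= (m ^+ 2 - `|m * n| + n ^+ 2 - 1)%:~R.
  rewrite ler0z; suff : `|m * n| <= m ^+ 2 + n ^+ 2 - 1 by lia.
  (* These give 4 |m n| <= 4 m^2 + n^2; when n^2 = 1, integrality of |m n| is what closes the
     gap. *)
  have := sqr_ge0 (2 * m - n); have := sqr_ge0 (2 * m + n).
  have -> : (2 * m + n) ^+ 2 = 4 * m ^+ 2 + 4 * (m * n) + n ^+ 2 by ring.
  have -> : (2 * m - n) ^+ 2 = 4 * m ^+ 2 - 4 * (m * n) + n ^+ 2 by ring.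
  by rewrite ler_norml; move: (m ^+ 2) (m * n) (n ^+ 2) n2 => A B C; lia.
have hn : (1 : R) <= (n ^+ 2)%:~R by rewrite -[leLHS]/(1%:~R) ler_int.
have hm : - `|m * n|%:~R <= 2 * (m%:~R * n%:~R) * x :> R.
  move: xb => /andP[x0 x1]; rewrite -intrM intr_norm; move: ((m * n)%:~R : R) => M.
  have [M0|M0] := lerP 0 M.
    by rewrite ger0_norm//; have := mulr_ge0 M0 x0; lra.
  have : 0 <= - M * (1 / 2 - x) by rewrite mulr_ge0 ?subr_ge0// oppr_ge0 ltW.
  by rewrite ltr0_norm//; lra.
move: h hn hm; rewrite !(intrD, intrM, rmorphXn, rmorphN, rmorphB) /=.
set N := `|_|%:~R; move: (m%:~R : R) (n%:~R : R) N => M K N h hn hm.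
have : 0 <= (K ^+ 2 - 1) * (x ^+ 2 + y ^+ 2 - 1) by rewrite mulr_ge0 ?subr_ge0.
by nra.
Qed.

Lemma sqr_norm_Lambda_ge1 (m n : int) : (m != 0) || (n != 0) ->
  1 <= (m%:~R + n%:~R * x) ^+ 2 + (n%:~R * y) ^+ 2.
Proof.
case: (eqVneq n 0) => [->|n0 _]; last by apply: le_trans xy (sqr_norm_Lambda_ge _ _ n0).
rewrite orbF => m0; rewrite !mul0r addr0 expr0n addr0 -rmorphXn /= -[leLHS]/(1%:~R) ler_int; nia.
Qed.

Lemma disk_Lambda_sqr r v : (disk r `&` Lambda tau) v ->
  exists m n : int, v = colv (m%:~R + n%:~R * x) (n%:~R * y) /\
    (m%:~R + n%:~R * x) ^+ 2 + (n%:~R * y) ^+ 2 <= r ^+ 2.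
Proof.
move=> [dv /LambdaP[m [n [v0 v1]]]]; exists m, n; split; first by rewrite -v0 -v1 colvK.
move: dv; rewrite /disk /= -{1}(colvK v) enorm_colv v0 v1 /= => dv.
have r0 : 0 <= r by apply: le_trans dv; exact: sqrtr_ge0.
by rewrite -[leLHS]sqr_sqrtr ?addr_ge0 ?sqr_ge0// lerXn2r ?nnegrE ?sqrtr_ge0.
Qed.

Lemma Lambda_e1 : Lambda tau (colv 1 0).
Proof. by have := Lambda_colv tau 1 0; rewrite !mul0r addr0. Qed.

Lemma Lambda_e2 : Lambda tau (colv x y).
Proof. by have := Lambda_colv tau 0 1; rewrite !mul1r add0r. Qed.

(** The horizontal basis vector has norm 1, and a smaller disk meets the lattice at most in 0. *)
Lemma succ_min1_Lambda : succ_min 1 (Lambda tau) = 1.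
Proof.
apply: inf_attained => [|r [r0 [U [_ UW]]]].
  split=> //; have [U UP] := is_span_exists (disk 1 `&` Lambda tau); exists U => //.
  have eU : colv 1 0 \in U.
    apply: (UP.1); split; last exact: Lambda_e1.
    by rewrite /disk /= enorm_colv expr1n expr0n addr0 sqrtr1.
  rewrite lt0n dimv_eq0; apply: contraTneq eU => ->.
  rewrite memv0; apply/eqP => /(congr1 (fun v : 'cV[R]_2 => v 0 0)).
  by rewrite colv0 mxE => /eqP; rewrite oner_eq0.
rewrite leNgt; apply: contraTN => r1; rewrite -ltnNge ltnS leqn0 dimv_eq0 -subv0.
apply: UW => v /disk_Lambda_sqr[m [n [-> rr]]].
have [/andP[/eqP -> /eqP ->]|] := boolP ((m == 0) && (n == 0)).
  by rewrite memv0; apply/eqP/colP => i; rewrite !mxE !mul0r addr0; case: ifP.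
rewrite negb_and => /sqr_norm_Lambda_ge1; rewrite leNgt => /negP; case.
by apply: le_lt_trans rr _; rewrite expr_lt1// ltW.
Qed.

(** Both basis vectors lie in the disk of radius [rho], since [rho] >= 1; in a smaller disk every
    lattice vector has n = 0, hence lies on the horizontal line. *)
Lemma succ_min2_Lambda : succ_min 2 (Lambda tau) = Num.sqrt (x ^+ 2 + y ^+ 2).
Proof.
set rho := Num.sqrt _.
have rho1 : 1 <= rho by rewrite -sqrtr1 ler_wsqrtr.
have e0 : colv 1 0 != 0.
  apply/eqP => /(congr1 (fun v : 'cV[R]_2 => v 0 0)).
  by rewrite colv0 mxE => /eqP; rewrite oner_eq0.
apply: inf_attained => [|r [r0 [U [_ UW]]]].
  split; first lra.
  have [U UP] := is_span_exists (disk rho `&` Lambda tau); exists U => //.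
  have e1U : colv 1 0 \in U.
    apply: (UP.1); split; last exact: Lambda_e1.
    by rewrite /disk /= enorm_colv expr1n expr0n addr0 sqrtr1.
  have e2U : colv x y \in U.
    by apply: (UP.1); split; [rewrite /disk /= enorm_colv | exact: Lambda_e2].
  have fr : free [:: colv x y; colv 1 0].
    rewrite free_cons seq1_free e0 andbT span_seq1; apply/vlineP => -[k].
    move=> /(congr1 (fun v : 'cV[R]_2 => v 1 0)); rewrite [RHS]mxE !colv1 mulr0 => yE.
    by move: y0; rewrite yE ltxx.
  apply: (@leq_trans (\dim <<[:: colv x y; colv 1 0]>>)); first by rewrite (eqP fr).
  by apply: dimvS; apply/span_subvP => v; rewrite !inE => /orP[] /eqP ->.
rewrite leNgt; apply: contraTN => r1; rewrite -ltnNge ltnS.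
apply: (@leq_trans (\dim <[colv 1 0]>)); last by rewrite dim_vline e0.
apply: dimvS; apply: UW => v /disk_Lambda_sqr[m [n [-> rr]]].
have [->|/(sqr_norm_Lambda_ge m)] := eqVneq n 0.
  apply/vlineP; exists m%:~R; apply/colP => i.
  by rewrite !mxE !mul0r addr0; case: ifP; rewrite ?mulr1 ?mulr0.
rewrite leNgt => /negP; case; apply: le_lt_trans rr _.
rewrite -[ltRHS]sqr_sqrtr ?addr_ge0 ?sqr_ge0// ltrXn2r// ?nnegrE ?ltW//.
Qed.

Lemma well_rounded_Lambda : well_rounded (Lambda tau) <-> x ^+ 2 + y ^+ 2 = 1.
Proof.
rewrite /well_rounded succ_min1_Lambda succ_min2_Lambda; split=> [E|->].
  by rewrite -[LHS]sqr_sqrtr -?E ?expr1n// addr_ge0 ?sqr_ge0.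
by rewrite sqrtr1.
Qed.

Lemma det_Lambda_mx : \det (Lambda_mx tau) = y.
Proof.
rewrite -det_tr det_trig.
  by rewrite !big_ord_recl big_ord0 !mxE /= mul1r mulr1.
by apply/is_trig_mxP => -[[|[|//]]] i [[|[|//]]] j //= _; rewrite !mxE.
Qed.

Lemma is_basis_Lambda : is_basis (Lambda_mx tau) (Lambda tau).
Proof. by split=> //; rewrite unitmxE det_Lambda_mx unitfE gt_eqF. Qed.

Lemma semi_stable_Lambda : semi_stable (Lambda tau) <-> y <= 1.
Proof.
rewrite /semi_stable succ_min1_Lambda; split=> [[A bA]|y1].
  rewrite (norm_det_basis _ _ _ bA is_basis_Lambda) det_Lambda_mx ger0_norm ?(ltW y0)//.
  by move=> s1; rewrite -[y]sqr_sqrtr ?(ltW y0)// exprn_ile1// sqrtr_ge0.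
exists (Lambda_mx tau); first exact: is_basis_Lambda.
by rewrite det_Lambda_mx ger0_norm ?(ltW y0)// -[leRHS]sqrtr1 ler_wsqrtr.
Qed.
End Minima.
End LatticeGeometry.

(** * Arithmetic parameters *)


(** [admissible] with denominators cleared and the common sign of c and d normalized. Positivity of
    c follows from the last inequality, as 1 - (a / b)^2 >= 3 / 4. *)
Definition arith_param (a b c d : nat) : bool :=
  [&& (0 < b)%N, (2 * a <= b)%N, coprime a b, (0 < d)%N, coprime c d &
      (b ^ 2 * d <= c * b ^ 2 + a ^ 2 * d)%N].

Section ArithmeticParameters.
Variable R : realType.

Definition Lambda_of (a b c d : nat) : set 'cV[R]_2 := Lambda (tau_of R a b c d).

Lemma natr_sqrM (m n : nat) : (m ^ 2 * n)%:R = m%:R ^+ 2 * n%:R :> R.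
Proof. by rewrite natrM natrX. Qed.

Lemma natrM_sqr (m n : nat) : (m * n ^ 2)%:R = m%:R * n%:R ^+ 2 :> R.
Proof. by rewrite natrM natrX. Qed.

Lemma arith_param_bounds (a b c d : nat) : arith_param a b c d ->
  [/\ 0 < b%:R :> R, 0 < d%:R :> R, 0 < c%:R / d%:R :> R,
      0 <= (a%:R / b%:R : R) <= 1 / 2
    & 1 <= (a%:R / b%:R) ^+ 2 + c%:R / d%:R :> R].
Proof.
case/and5P => b0 ab _ d0 /andP[_ h].
have br : 0 < b%:R :> R by rewrite ltr0n.
have dr : 0 < d%:R :> R by rewrite ltr0n.
have ar : 0 <= a%:R :> R by [].
have abr : 2 * a%:R <= b%:R :> R by rewrite -natrM ler_nat.
have hr : b%:R ^+ 2 * d%:R <= c%:R * b%:R ^+ 2 + a%:R ^+ 2 * d%:R :> R.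
  by rewrite -!natrX -!natrM -natrD ler_nat.
have xb : 0 <= (a%:R / b%:R : R) <= 1 / 2.
  by rewrite divr_ge0//= ler_pdivrMr//; lra.
have q : 1 <= (a%:R / b%:R) ^+ 2 + c%:R / d%:R :> R.
  have p : 0 < b%:R ^+ 2 * d%:R :> R by rewrite mulr_gt0// exprn_gt0.
  rewrite -(ler_pM2l p) mulr1 (_ : _ * (_ + _) = c%:R * b%:R ^+ 2 + a%:R ^+ 2 * d%:R)//.
  by field; rewrite !gt_eqF.
split=> //; move: xb q; set x := _ / b%:R; set z := c%:R / _; clearbody x z => /andP[x0 x1] q; nra.
Qed.

Lemma arith_param_geometry (a b c d : nat) : arith_param a b c d ->
  let x : R := a%:R / b%:R in let y : R := Num.sqrt (c%:R / d%:R) in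
  [/\ 0 < y, 0 <= x <= 1 / 2 & 1 <= x ^+ 2 + y ^+ 2].
Proof.
by case/arith_param_bounds => ? ? z0 ? ?; split; rewrite ?sqrtr_gt0// sqr_sqrtr// ltW.
Qed.

Lemma admissible_of_nat (a b c d : nat) : arith_param a b c d -> admissible R a b c d.
Proof.
move=> P; have [br dr z0 /andP[x0 x1] q] := arith_param_bounds _ _ _ _ P.
case/and5P: P => b0 ab cab d0 /andP[ccd h].
split.
- by rewrite -!lt0n.
- by [].
- split=> //; move: x1; rewrite ler_pdivrMr//; lra.
- by move: q; rewrite expr_div_n; lra.
Qed.

(* In an admissible quadruple c and d may both be negative. *)
Lemma nat_of_admissible (a b c d : int) : admissible R a b c d ->
  arith_param `|a| `|b| `|c| `|d| /\ tau_of R a b c d = tau_of R `|a|%N `|b|%N `|c|%N `|d|%N.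
Proof.
move=> [[b0 d0] [cab ccd] [a0 ab] h].
have ar : 0 <= a%:~R :> R by rewrite ler0z.
have bp : 0 < b.
  rewrite lt_neqAle eq_sym b0 /= -(ler0z R); lra.
have br : 0 < b%:~R :> R by rewrite ltr0z.
have aE : `|a|%N = a :> int by rewrite gez0_abs.
have bE : `|b|%N = b :> int by rewrite gez0_abs// ltW.
have z0 : 0 < c%:~R / d%:~R :> R.
  apply: lt_le_trans h; rewrite subr_gt0 ltr_pdivrMr ?exprn_gt0//; nra.
have dn0 : 0 < `|d|%N%:R :> R by rewrite ltr0n absz_gt0.
have zE : `|c|%N%:R / `|d|%N%:R = c%:~R / d%:~R :> R.
  by rewrite -[RHS]gtr0_norm// normf_div !natr_absz !intr_norm.
split; last by rewrite /tau_of aE bE -!pmulrn zE.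
have aR : `|a|%N%:R = a%:~R :> R by rewrite -[in RHS]aE.
have bR : `|b|%N%:R = b%:~R :> R by rewrite -[in RHS]bE.
apply/and5P; split.
- by rewrite absz_gt0.
- by rewrite -(ler_nat R) natrM aR bR; lra.
- by [].
- by rewrite absz_gt0.
- apply/andP; split=> //.
  rewrite -(ler_nat R) natrD natrM_sqr !natr_sqrM aR bR.
  have := h; rewrite -zE lerBlDr => h2.
  have p : 0 < b%:~R ^+ 2 * `|d|%N%:R :> R by rewrite mulr_gt0// exprn_gt0.
  move: h2; rewrite -(ler_pM2l p) mulr1.
  rewrite (_ : _ * (_ + _) = `|c|%N%:R * b%:~R ^+ 2 + a%:~R ^+ 2 * `|d|%N%:R)//.
  by field; rewrite !gt_eqF.
Qed.

Lemma reduced_fraction_inj (a b a' b' : nat) : (0 < b)%N -> (0 < b')%N ->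
  coprime a b -> coprime a' b' -> a%:R / b%:R = a'%:R / b'%:R :> R -> a = a' /\ b = b'.
Proof.
move=> b0 b'0 cab cab' E.
have {}E : (a * b' = a' * b)%N.
  apply/eqP; rewrite -(eqr_nat R) !natrM -eqr_div ?pnatr_eq0 -?lt0n//; exact/eqP.
have bb : b = b'.
  apply/eqP; rewrite eqn_dvd; apply/andP; split.
    by rewrite -(@Gauss_dvdr b a) 1?coprime_sym// E dvdn_mull.
  by rewrite -(@Gauss_dvdr b' a') 1?coprime_sym// -E dvdn_mull.
by split=> //; move: E; rewrite bb => /eqP; rewrite eqn_pmul2r// => /eqP.
Qed.

Lemma Lambda_of_inj (a b c d a' b' c' d' : nat) :
  arith_param a b c d -> arith_param a' b' c' d' ->
  Lambda_of a b c d = Lambda_of a' b' c' d' -> [/\ a = a', b = b', c = c' & d = d'].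
Proof.
move=> P P'; have [y0 xb _] := arith_param_geometry _ _ _ _ P.
have [y'0 x'b _] := arith_param_geometry _ _ _ _ P'.
move=> /(Lambda_inj _ (tau_of R a b c d) (tau_of R a' b' c' d') y0 xb y'0 x'b)[xE yE].
have [_ _ z0 _ _] := arith_param_bounds _ _ _ _ P.
have [_ _ z'0 _ _] := arith_param_bounds _ _ _ _ P'.
case/and5P: P => b0 _ cab d0 /andP[ccd _].
case/and5P: P' => b'0 _ cab' d'0 /andP[ccd' _].
have [-> ->] := reduced_fraction_inj _ _ _ _ b0 b'0 cab cab' xE.
have [-> ->] // : c = c' /\ d = d'.
apply: reduced_fraction_inj => //.
by rewrite -[LHS]sqr_sqrtr ?ltW// -[RHS]sqr_sqrtr ?ltW// yE.
Qed.

Lemma fund_dom_tau_of (a b c d : nat) : arith_param a b c d -> fund_dom (tau_of R a b c d).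
Proof.
move=> P; have [y0 xb q] := arith_param_geometry _ _ _ _ P.
split; [exact: (ltW y0) | exact: xb |].
rewrite lecE /= eqxx /= -[leLHS]sqrtr1; exact: ler_wsqrtr.
Qed.

(** The Gram matrix has entries 1, x and x^2 + y^2, all rational, so its entries span the rational
    line through t = 1. *)
Lemma arithmetic_Lambda_of (a b c d : nat) : arith_param a b c d ->
  Defs.arithmetic (Lambda_of a b c d).
Proof.
move=> P; have [y0 xb q] := arith_param_geometry _ _ _ _ P.
have [_ _ z0 _ _] := arith_param_bounds _ _ _ _ P.
exists (Lambda_mx (tau_of R a b c d)); first exact: is_basis_Lambda.
exists 1; first exact: oner_neq0.
set A := Lambda_mx _; set G := A^T *m A.
have [g gE] : exists g : 'M[rat]_2, forall i j, ratr (g i j) = G i j.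
  pose x : rat := a%:R / b%:R; pose z : rat := c%:R / d%:R.
  exists (\matrix_(i, j) if i == 0 then (if j == 0 then 1 else x)
            else (if j == 0 then x else x ^+ 2 + z)).
  have xE : ratr x = a%:R / b%:R :> R by rewrite fmorph_div /= !ratr_nat.
  have zE : ratr z = c%:R / d%:R :> R by rewrite fmorph_div /= !ratr_nat.
  move=> i j; rewrite !mxE !big_ord_recl big_ord0 !mxE /= addr0.
  case: (i == 0); case: (j == 0); rewrite ?rmorph1 ?xE ?mulr1 ?mul1r ?mulr0 ?mul0r ?addr0//.
  by rewrite rmorphD rmorphXn /= xE zE -!expr2 sqr_sqrtr// ltW.
apply/seteqP; split=> [_ [q' _ <-]|_ [q' _ <-]].
  exists (\sum_i \sum_j q' i j * g i j) => //.
  rewrite mulr1 rmorph_sum; apply: eq_bigr => i _; rewrite rmorph_sum.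
  by apply: eq_bigr => j _; rewrite rmorphM /= gE.
(* Any rational is reached through the corner entry of the Gram matrix, which is 1. *)
exists (\matrix_(i, j) if (i == 0) && (j == 0) then q' else 0) => //.
rewrite !big_ord_recl !big_ord0 !mxE /= !big_ord_recl !big_ord0 !mxE /= .
by rewrite !rmorph0 !mul0r !addr0 !mulr1.
Qed.

Lemma well_rounded_Lambda_of (a b c d : nat) : arith_param a b c d ->
  well_rounded (Lambda_of a b c d) <-> (b ^ 2 * d = c * b ^ 2 + a ^ 2 * d)%N.
Proof.
move=> P; have [y0 xb q] := arith_param_geometry _ _ _ _ P.
have [br dr z0 _ _] := arith_param_bounds _ _ _ _ P.
have := well_rounded_Lambda _ _ _ y0 xb q; rewrite sqr_sqrtr ?(ltW z0)// => W.
have p : b%:R ^+ 2 * d%:R != 0 :> R by rewrite mulf_neq0 ?expf_neq0// gt_eqF.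
have F : b%:R ^+ 2 * d%:R * ((a%:R / b%:R) ^+ 2 + c%:R / d%:R) =
    c%:R * b%:R ^+ 2 + a%:R ^+ 2 * d%:R :> R by field; rewrite !gt_eqF.
apply: iff_trans W _; split=> E.
  by apply/eqP; rewrite -(eqr_nat R) natrD natrM_sqr !natr_sqrM -F E mulr1.
apply: (mulfI p); rewrite F mulr1 -natrM_sqr -!natr_sqrM -natrD.
by rewrite E.
Qed.

Lemma semi_stable_Lambda_of (a b c d : nat) : arith_param a b c d ->
  semi_stable (Lambda_of a b c d) <-> (c <= d)%N.
Proof.
move=> P; have [y0 xb q] := arith_param_geometry _ _ _ _ P.
have [br dr z0 _ _] := arith_param_bounds _ _ _ _ P.
apply: iff_trans (semi_stable_Lambda _ _ _ y0 xb q) _.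
rewrite -[X in _ <= X]sqrtr1 ler_sqrt ?ltr01// ler_pdivrMr// mul1r ler_nat.
by [].
Qed.

Lemma arith_leE (T : nat) (L : set 'cV[R]_2) : arith_le T L <->
  exists a b c d : nat, [/\ arith_param a b c d, L = Lambda_of a b c d,
    (a <= T)%N /\ (b <= T)%N & (c <= T)%N /\ (d <= T)%N].
Proof.
split=> [[_ _ [h [a [b [c [d [adm LE ->]]]]]]]|[a [b [c [d [P -> [aT bT] [cT dT]]]]]]].
  rewrite !geq_max => /andP[/andP[aT bT] /andP[cT dT]].
  have [P tE] := nat_of_admissible _ _ _ _ adm.
  by exists `|a|%N, `|b|%N, `|c|%N, `|d|%N; split=> //; rewrite LE tE.
split.
- by exists (tau_of R a b c d) => //; exact: fund_dom_tau_of.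
- exact: arithmetic_Lambda_of.
- exists (maxn (maxn a b) (maxn c d)); last by rewrite !geq_max aT bT cT dT.
  by exists a, b, c, d; split=> //; exact: admissible_of_nat.
Qed.

End ArithmeticParameters.

(** * The counting functions as coprime sums *)


Section Counting.
Variable R : realType.

Definition param_count (T : nat) (q : nat -> nat -> nat -> nat -> bool) : nat :=
  #|[set p : ('I_T.+1 * 'I_T.+1) * ('I_T.+1 * 'I_T.+1) |
      arith_param p.1.1 p.1.2 p.2.1 p.2.2 && q p.1.1 p.1.2 p.2.1 p.2.2]%SET|.

(** [Lambda_of] is injective on admissible parameters, so the classes are the bijective image of a
    finite set of quadruples. Exhibiting this image also proves finiteness, without which [fset_set]
    would return its default value. *)
Lemma card_arith_le (T : nat) (Q : set (set 'cV[R]_2)) (q : nat -> nat -> nat -> nat -> bool) :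
  (forall a b c d, arith_param a b c d -> Q (Lambda_of R a b c d) <-> q a b c d) ->
  #|` fset_set (arith_le T `&` Q)| = param_count T q.
Proof.
move=> Qq.
pose D := [set p : ('I_T.+1 * 'I_T.+1) * ('I_T.+1 * 'I_T.+1) |
      arith_param p.1.1 p.1.2 p.2.1 p.2.2 && q p.1.1 p.1.2 p.2.1 p.2.2]%SET.
pose f (p : ('I_T.+1 * 'I_T.+1) * ('I_T.+1 * 'I_T.+1)) := Lambda_of R p.1.1 p.1.2 p.2.1 p.2.2.
have finj : {in D &, injective f}.
  move=> [[a b] [c d]] [[a' b'] [c' d']]; rewrite !inE /= => /andP[P _] /andP[P' _].
  move=> /(Lambda_of_inj _ _ _ _ _ _ _ _ _ P P')[] /val_inj -> /val_inj ->.
  by move=> /val_inj -> /val_inj ->.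
have -> : arith_le T `&` Q = [set` [fset f p | p in D]%fset].
  apply/seteqP; split=> L.
    move=> [/arith_leE[a [b [c [d [P -> [aT bT] [cT dT]]]]]] /(Qq _ _ _ _ P) qP].
    apply/imfsetP.
    by exists ((Ordinal (aT : (a < T.+1)%N), Ordinal (bT : (b < T.+1)%N)), (Ordinal (cT : (c < T.+1)%N), Ordinal (dT : (d < T.+1)%N))) => //; rewrite !inE /= P.
  move=> /imfsetP[[[a b] [c d]]]; rewrite /= !inE /= => /andP[P qP] ->; split.
    by apply/arith_leE; exists a, b, c, d; split=> //; split; rewrite -ltnS ltn_ord.
  exact/(Qq _ _ _ _ P).
rewrite set_fsetK card_in_imfset//=.
by rewrite -cardE.
Qed.

Lemma N1E T : N1 R T = param_count T (fun _ _ _ _ => true).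
Proof. by rewrite /N1 -[arith_le T]setIT; exact: card_arith_le. Qed.

Lemma N2E T : N2 R T = param_count T (fun _ _ c d => c <= d)%N.
Proof. by apply: card_arith_le => a b c d; exact: semi_stable_Lambda_of. Qed.

Lemma N3E T :
  N3 R T = param_count T (fun a b c d => b ^ 2 * d == c * b ^ 2 + a ^ 2 * d)%N.
Proof.
apply: card_arith_le => a b c d P; apply: iff_trans (well_rounded_Lambda_of _ _ _ _ _ P) _.
by split=> /eqP.
Qed.

Lemma param_count_lt (T : nat) (q q' : nat -> nat -> nat -> nat -> bool) :
  (forall a b c d, arith_param a b c d -> q a b c d -> q' a b c d) ->
  (exists a b c d, [/\ arith_param a b c d, ~~ q a b c d & q' a b c d] /\
     [/\ a <= T, b <= T, c <= T & d <= T]%N) ->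
  (param_count T q < param_count T q')%N.
Proof.
move=> qq' [a [b [c [d [[P nq q'P] [aT bT cT dT]]]]]].
apply: proper_card; apply/properP; split.
  by apply/fintype.subsetP => p; rewrite !inE => /andP[Pp /(qq' _ _ _ _ Pp) ->]; rewrite Pp.
exists ((Ordinal (aT : (a < T.+1)%N), Ordinal (bT : (b < T.+1)%N)), (Ordinal (cT : (c < T.+1)%N), Ordinal (dT : (d < T.+1)%N))).
  by rewrite !inE /= P.
by rewrite !inE /= P.
Qed.

(** Strictness is witnessed at height 2: (1, 2, 1, 1) is semi-stable with |tau|^2 = 5 / 4, and (0,
    1, 2, 1) has y^2 = 2. At T = 1 only the square lattice is counted and the three numbers
    agree. *)
Lemma N3_lt_N2_lt_N1 (T : nat) : (2 <= T)%N -> (N3 R T < N2 R T < N1 R T)%N.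
Proof.
move=> T2; rewrite N1E N2E N3E; apply/andP; split.
  apply: param_count_lt => [a b c d|].
    case/and5P => b0 _ _ _ _ /eqP E.
    by rewrite -(@leq_pmul2r (b ^ 2)) ?expn_gt0 ?b0// mulnC [leqRHS]mulnC E mulnC leq_addr.
  by exists 1%N, 2%N, 1%N, 1%N; split=> //; split=> //; exact: ltnW.
apply: param_count_lt => //.
exists 0%N, 1%N, 2%N, 1%N; split=> //; split=> //; exact: ltnW.
Qed.

Lemma param_countE T q : (param_count T q)%:R =
  \sum_(0 <= a < T.+1) \sum_(0 <= b < T.+1) \sum_(0 <= c < T.+1) \sum_(0 <= d < T.+1)
    (arith_param a b c d && q a b c d)%:R :> R.
Proof.
pose F (a b c d : nat) : R := (arith_param a b c d && q a b c d)%:R.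
transitivity (\sum_(p : ('I_T.+1 * 'I_T.+1) * ('I_T.+1 * 'I_T.+1)) F p.1.1 p.1.2 p.2.1 p.2.2).
  rewrite /param_count -sum1dep_card natr_sum big_mkcond /=; apply: eq_bigr => p _.
  by rewrite /F; case: ifP.
rewrite -(pair_bigA _ (fun x y : 'I_T.+1 * 'I_T.+1 => F x.1 x.2 y.1 y.2)) /=.
rewrite -(pair_bigA _ (fun a b : 'I_T.+1 => \sum_(y : 'I_T.+1 * 'I_T.+1) F a b y.1 y.2)) /=.
rewrite big_mkord; apply: eq_bigr => a _; rewrite big_mkord; apply: eq_bigr => b _.
rewrite -(pair_bigA _ (fun c d : 'I_T.+1 => F a b c d)) /=.
by rewrite big_mkord; apply: eq_bigr => c _; rewrite big_mkord.
Qed.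

Lemma triangular_reindex (V : nmodType) (G : nat -> nat -> V) (T : nat) :
  (forall a b, ~~ ((0 < b) && (a <= b))%N -> G a b = 0) ->
  \sum_(0 <= a < T.+1) \sum_(0 <= b < T.+1) G a b =
  \sum_(1 <= b < T.+1) \sum_(0 <= a < b.+1) G a b.
Proof.
move=> G0; rewrite exchange_big /= big_ltn// big1 ?add0r => [|a _]; last exact: G0.
apply: eq_big_nat => b /andP[b0 bT].
rewrite (@big_cat_nat _ _ _ b.+1)//= [X in _ + X]big_nat [X in _ + X]big1 ?addr0// => a /andP[ba _].
by apply: G0; rewrite b0 -ltnNge.
Qed.

Definition half_row (a b : nat) : R := (2 * a <= b)%N%:R.

Definition stable_row (a b c d : nat) : R := (b ^ 2 * d <= c * b ^ 2 + a ^ 2 * d)%N%:R.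

(** Used for d / c < 1. The lower bound drops d = 0, which [coprime 0 1] would let in; the strict
    upper bound drops d = c, which is semi-stable. *)
Definition inner_row (a b : nat) : R := (0 < a < b)%N%:R.

(** Semi-stability c <= d is exactly the shape of a triangle, so (c, d) runs over a coprime triangle
    sum for each fixed (a, b). *)
Lemma N2_coprime_sum T : (N2 R T)%:R =
  coprime_tri_sum R (fun a b => half_row a b * coprime_tri_sum R (stable_row a b) T) T.
Proof.
rewrite N2E param_countE triangular_reindex => [|a b ab]; last first.
  rewrite !big1// => c _; rewrite big1// => d _.
  rewrite /arith_param; apply/eqP; rewrite pnatr_eq0 eqb0; apply: contra ab.
  by case/andP => /and5P[-> ab _ _ _] _; rewrite (leq_trans _ ab)// leq_pmull.
apply: eq_big_nat => b /andP[b0 bT]; rewrite [RHS]big_mkcond; apply: eq_bigr => a _.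
rewrite /half_row /arith_param b0 /=; case: (2 * a <= b)%N => /=; last first.
  by rewrite mul0r if_same big1// => c _; rewrite big1.
case: ifP => cab /=; last by rewrite big1// => c _; rewrite big1.
rewrite mul1r triangular_reindex => [|c d cd]; last first.
  apply/eqP; rewrite pnatr_eq0 eqb0; apply: contra cd.
  by case/andP => /and3P[-> _ _] ->.
apply: eq_big_nat => d /andP[d0 dT]; rewrite [RHS]big_mkcond.
apply: eq_big_nat => c /andP[_]; rewrite ltnS => cd.
by rewrite d0 cd andbT; case: coprime.
Qed.

(* If d < c then c / d >= 1 - (a / b)^2 holds automatically. *)
Lemma N1_coprime_sum T : (N1 R T)%:R = (N2 R T)%:R +
  coprime_tri_sum R half_row T * coprime_tri_sum R inner_row T.
Proof.
rewrite N1E N2E !param_countE.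
transitivity (\sum_(0 <= a < T.+1) \sum_(0 <= b < T.+1) \sum_(0 <= c < T.+1) \sum_(0 <= d < T.+1)
    ((arith_param a b c d && (c <= d)%N)%:R + (arith_param a b c d && (d < c)%N)%:R) : R).
  apply: eq_bigr => a _; apply: eq_bigr => b _; apply: eq_bigr => c _; apply: eq_bigr => d _.
  by case: (arith_param a b c d) => /=; case: (leqP c d); rewrite ?addr0 ?add0r.
transitivity (\sum_(0 <= a < T.+1) \sum_(0 <= b < T.+1) \sum_(0 <= c < T.+1) \sum_(0 <= d < T.+1)
      (arith_param a b c d && (c <= d)%N)%:R +
   \sum_(0 <= a < T.+1) \sum_(0 <= b < T.+1) \sum_(0 <= c < T.+1) \sum_(0 <= d < T.+1)
      (arith_param a b c d && (d < c)%N)%:R : R).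
  rewrite -big_split; apply: eq_bigr => a _; rewrite -big_split; apply: eq_bigr => b _.
  by rewrite -big_split; apply: eq_bigr => c _; rewrite -big_split.
congr (_ + _).
rewrite triangular_reindex => [|a b ab]; last first.
  rewrite !big1// => c _; rewrite big1// => d _.
  rewrite /arith_param; apply/eqP; rewrite pnatr_eq0 eqb0; apply: contra ab.
  by case/andP => /and5P[-> ab _ _ _] _; rewrite (leq_trans _ ab)// leq_pmull.
rewrite big_distrl /=.
apply: eq_big_nat => b /andP[b0 bT]; rewrite big_distrl [RHS]big_mkcond; apply: eq_bigr => a _.
rewrite /half_row /arith_param b0 /=; case: (2 * a <= b)%N => /=; last first.
  by rewrite mul0r if_same big1// => c _; rewrite big1.
case: ifP => cab /=; last by rewrite big1// => c _; rewrite big1.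
(* Here c and d change roles, so that the triangle is indexed by d / c. *)
rewrite mul1r exchange_big triangular_reindex => [|d c cd]; last first.
  apply/eqP; rewrite pnatr_eq0 eqb0; apply: contra cd.
  by case/andP => _ dc; rewrite (leq_ltn_trans _ dc)// ltnW.
apply: eq_big_nat => c /andP[c0 cT]; rewrite [RHS]big_mkcond.
apply: eq_big_nat => d /andP[_]; rewrite ltnS => dc.
rewrite /inner_row [coprime d c]coprime_sym; case: (coprime c d); rewrite ?andbF//=.
case: (posnP d) => //= d0; case: (ltnP d c) => //= dlc; rewrite ?andbF// andbT.
by rewrite (leq_trans _ (leq_addr _ _))// mulnC leq_mul2r (ltnW dlc) orbT.
Qed.

Lemma sum_indicator (k n : nat) : (k < n)%N -> \sum_(0 <= i < n) (i == k)%:R = 1 :> R.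
Proof.
move=> kn; rewrite big_mkord (bigD1 (Ordinal kn))//= eqxx big1 ?addr0// => i.
by rewrite -val_eqE /= => /negbTE ->.
Qed.

(** Here m is the integer part of the square root of T. If a / b is reduced then so is (b^2 - a^2) /
    b^2, so each a / b carries one well-rounded class, of height b^2, and b^2 <= T means b <= m. *)
Lemma N3_coprime_sum T m : (m ^ 2 <= T < m.+1 ^ 2)%N ->
  (N3 R T)%:R = coprime_tri_sum R half_row m.
Proof.
move=> /andP[mT Tm]; rewrite N3E param_countE.
rewrite triangular_reindex => [|a b ab]; last first.
  rewrite !big1// => c _; rewrite big1// => d _.
  rewrite /arith_param; apply/eqP; rewrite pnatr_eq0 eqb0; apply: contra ab.
  by case/andP => /and5P[-> ab _ _ _] _; rewrite (leq_trans _ ab)// leq_pmull.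
have mT' : (m <= T)%N by apply: leq_trans mT; case: (m) => // n; rewrite -mulnn leq_pmulr.
transitivity (\sum_(1 <= b < T.+1) \sum_(0 <= a < b.+1)
   ([&& b <= m, coprime a b & 2 * a <= b]%N)%:R : R).
  apply: eq_big_nat => b /andP[b0 bT]; apply: eq_big_nat => a /andP[_ ab].
  have bmE : (b <= m)%N = (b ^ 2 <= T)%N.
    apply/idP/idP => [bm|bT2]; first by apply: leq_trans mT; rewrite leq_exp2r.
    by rewrite -ltnS -(@ltn_exp2r _ _ 2)// (leq_ltn_trans bT2).
  case: (boolP [&& _, _ & _]) => [/and3P[bm cab hab]|nab]; last first.
    rewrite big_nat big1// => c /andP[_ cT]; rewrite big_nat big1// => d /andP[_ dT].
    apply/eqP; rewrite pnatr_eq0 eqb0; apply: contra nab => /andP[/and5P[_ hab cab d0 /andP[ccd _]] /eqP E].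
    rewrite cab hab !andbT bmE -ltnS; apply: leq_trans dT; rewrite ltnS; apply: dvdn_leq => //.
    (* As b^2 is prime to a^2, it divides d, whence b^2 <= d <= T. *)
    have : (b ^ 2 %| a ^ 2 * d)%N.
      by rewrite -(dvdn_addr _ (dvdn_mull c (dvdnn (b ^ 2)))) -E dvdn_mulr.
    by rewrite Gauss_dvdr// coprimeXl// coprimeXr// coprime_sym.
  have a2b2 : (a ^ 2 <= b ^ 2)%N by rewrite leq_exp2r.
  have cop : coprime (b ^ 2 - a ^ 2) (b ^ 2).
    rewrite -{2}(subnK a2b2) /coprime gcdnDl gcdnC -gcdnDr subnK//.
    by rewrite -/(coprime _ _) coprimeXl// coprimeXr.
  rewrite bmE in bm; have b20 : (0 < b ^ 2)%N by rewrite expn_gt0 b0.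
  transitivity (\sum_(0 <= c < T.+1) \sum_(0 <= d < T.+1)
      ((c == b ^ 2 - a ^ 2) && (d == b ^ 2))%N%:R : R).
    apply: eq_bigr => c _; apply: eq_bigr => d _; congr (_%:R); congr nat_of_bool.
    apply/andP/andP => [[/and5P[_ _ _ d0 /andP[ccd _]] /eqP E]|[/eqP -> /eqP ->]].
      have [-> ->] // : c = (b ^ 2 - a ^ 2)%N /\ d = (b ^ 2)%N.
      apply: (@reduced_fraction_inj R) => //; apply/eqP.
      rewrite eqr_div ?pnatr_eq0 -?lt0n// -!natrM eqr_nat mulnBl E addnK; exact/eqP.
    have e : (b ^ 2 * b ^ 2 = (b ^ 2 - a ^ 2) * b ^ 2 + a ^ 2 * b ^ 2)%N.
      by rewrite -mulnDl subnK.
    by rewrite /arith_param b0 hab cab b20 cop -e leqnn eqxx.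
  transitivity ((\sum_(0 <= c < T.+1) (c == b ^ 2 - a ^ 2)%N%:R) *
      \sum_(0 <= d < T.+1) (d == b ^ 2)%N%:R : R).
    rewrite big_distrl; apply: eq_bigr => c _; rewrite big_distrr; apply: eq_bigr => d _.
    by rewrite /= -natrM mulnb.
  by rewrite !sum_indicator ?mulr1// ltnS (leq_trans (leq_subr _ _)).
rewrite (@big_cat_nat _ _ _ m.+1)//= [X in _ + X]big_nat [X in _ + X]big1 ?addr0; last first.
  by move=> b /andP[mb _]; rewrite big1// => a _; rewrite leqNgt mb.
apply: eq_big_nat => b /andP[_]; rewrite ltnS => bm; rewrite [RHS]big_mkcond.
by apply: eq_bigr => a _; rewrite /half_row bm /=; case: (coprime a b).
Qed.

End Counting.

(** * Sums over all pairs *)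


Section RowSums.
Variable R : realType.

(* Row b may be replaced by 2 al b, because these sum to al M (M + 1). *)
Lemma tri_sum_row_bound (F : nat -> nat -> R) (al K : R) (M : nat) :
  (forall b, (0 < b)%N -> `|\sum_(0 <= a < b.+1) F a b - 2 * al * b%:R| <= K) ->
  `|tri_sum R F M - al * M%:R ^+ 2| <= (K + `|al|) * M%:R.
Proof.
move=> row.
have -> : tri_sum R F M - al * M%:R ^+ 2 =
    \sum_(1 <= b < M.+1) (\sum_(0 <= a < b.+1) F a b - 2 * al * b%:R) + al * M%:R.
  rewrite /tri_sum; elim: M => [|n IH]; first by rewrite !big_geq// expr0n !mulr0 subrr addr0.
  move/(canRL (subrK _)): IH => IH.
  by rewrite big_nat_recr// [in RHS]big_nat_recr//= IH -natr1; ring.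
apply: le_trans (ler_normD _ _) _; rewrite [leRHS]mulrDl lerD//; last by rewrite normrM normr_nat.
apply: le_trans (ler_norm_sum _ _ _) _.
apply: (@le_trans _ _ (\sum_(1 <= b < M.+1) K)).
  by apply: ler_sum_nat => b /andP[b0 _]; exact: row.
by rewrite sumr_const_nat subn1 mulr_natr.
Qed.

Lemma sum_initial_segment (f : nat -> R) (q n : nat) : (q <= n)%N ->
  \sum_(0 <= a < n.+1) (a <= q)%N%:R * f a = \sum_(0 <= a < q.+1) f a.
Proof.
move=> qn; rewrite (@big_cat_nat _ _ _ q.+1)//= [X in _ + X]big_nat [X in _ + X]big1 ?addr0.
  by apply: eq_big_nat => a /andP[_]; rewrite ltnS => ->; rewrite mul1r.
by move=> a /andP[qa _]; rewrite leqNgt qa mul0r.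
Qed.

Lemma half_rowE a b : half_row R a b = (a <= b %/ 2)%N%:R.
Proof. by rewrite /half_row leq_divRL// mulnC. Qed.

Lemma homogeneous_half_row : homogeneous0 R (half_row R).
Proof. by move=> k a b k0 _; rewrite /half_row mulnCA leq_pmul2l. Qed.

(** Row b has [b %/ 2] + 1 entries, within 1 of b / 2 = 2 (1/4) b; the constant 2 covers 1 + 1/4. *)
Lemma half_row_bound M :
  `|tri_sum R (half_row R) M - 1 / 4 * M%:R ^+ 2| <= 2 * M%:R.
Proof.
apply: le_trans (@tri_sum_row_bound _ _ 1 _ _) _; last first.
  by rewrite ler_wpM2r// ger0_norm; lra.
move=> b b0; under eq_bigr do rewrite half_rowE -[_%:R]mulr1.
rewrite (@sum_initial_segment (fun=> 1)) ?leq_div// sumr_const_nat subn0 -natr1.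
have [] := @divn_approx R b 2 isT; rewrite ler_norml; lra.
Qed.

(** The factor (a / b)^2 is the length of the interval [1 - (a / b)^2, 1] in which c / d lies for a
    semi-stable class. *)
Definition square_row (a b : nat) : R := half_row R a b * (a%:R / b%:R) ^+ 2.

Lemma homogeneous_square_row : homogeneous0 R square_row.
Proof.
move=> k a b k0 b0; rewrite /square_row homogeneous_half_row// !natrM.
by rewrite -mulf_div divff ?mul1r// pnatr_eq0 -lt0n.
Qed.

Lemma sum_squares (q : nat) :
  \sum_(0 <= a < q.+1) a%:R ^+ 2 = q%:R * (q%:R + 1) * (2 * q%:R + 1) / 6 :> R.
Proof.
elim: q => [|q IH]; first by rewrite big_nat1 expr0n !mul0r.
by rewrite big_nat_recr// IH /= -natr1; field.
Qed.

(** The integral of x^2 over [0, 1/2] is 1/24, so row b sums to about b / 24 = 2 (1/48) b. *)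
Lemma square_row_bound M :
  `|tri_sum R square_row M - 1 / 48 * M%:R ^+ 2| <= 2 * M%:R.
Proof.
apply: le_trans (@tri_sum_row_bound _ _ 1 _ _) _; last first.
  by rewrite ler_wpM2r// ger0_norm; lra.
move=> b b0; rewrite /square_row; under eq_bigr do rewrite half_rowE expr_div_n mulrA.
rewrite -big_distrl /= (@sum_initial_segment (fun a => a%:R ^+ 2)) ?leq_div// sum_squares.
have b1 : 1 <= b%:R :> R by rewrite ler1n.
have [] := @divn_approx R b 2 isT; move: b1 (ler0n R (b %/ 2)).
move: (b%:R : R) ((b %/ 2)%:R : R) => B q B1 q0 qB Bq.
rewrite (_ : _ - _ = (4 * q * (q + 1) * (2 * q + 1) - B ^+ 3) / (24 * B ^+ 2)); last first.
  by field; rewrite gt_eqF//; lra.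
have B2 : 0 < 24 * B ^+ 2 by rewrite mulr_gt0// exprn_gt0//; lra.
rewrite normf_div [X in _ / X]gtr0_norm// ler_pdivrMr// mul1r ler_norml.
apply/andP; split.
  (* For B >= 2 the three factors are compared one by one using 2 q >= B - 2; below 2 the factor B -
     2 is negative and B^3 <= 24 B^2 is enough. *)
  have [B2'|B2'] := lerP 2 B; last by nra.
  have h : (B - 2) * B * (B - 1) <= (2 * q) * (2 * q + 2) * (2 * q + 1).
    by rewrite !ler_pM ?mulr_ge0//; lra.
  by nra.
have h : (2 * q) * (2 * q + 2) <= B * (B + 2) by rewrite ler_pM//; lra.
have h2 : (2 * q) * (2 * q + 2) * (2 * q + 1) <= B * (B + 2) * (B + 1).
  by rewrite ler_pM ?mulr_ge0//; lra.
nra.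
Qed.

Lemma homogeneous_stable_row a b : homogeneous0 R (stable_row R a b).
Proof.
move=> k c d k0 _; rewrite /stable_row -(mulnA k c) !(mulnCA _ k d).
by rewrite -mulnDr leq_pmul2l.
Qed.

(* In row d the admissible c are d - e with e <= (a / b)^2 d. *)
Lemma stable_row_bound a b M : (0 < b)%N -> (2 * a <= b)%N ->
  `|tri_sum R (stable_row R a b) M - (a%:R / b%:R) ^+ 2 / 2 * M%:R ^+ 2| <= 2 * M%:R.
Proof.
move=> b0 ab.
have br : 0 < b%:R :> R by rewrite ltr0n.
have x01 : 0 <= (a%:R / b%:R : R) <= 1.
  rewrite divr_ge0//= ler_pdivrMr// mul1r ler_nat; lia.
apply: le_trans (@tri_sum_row_bound _ _ 1 _ _) _; last first.
  rewrite ler_wpM2r// ger0_norm; move: x01; set x := a%:R / _; clearbody x => /andP[? ?]; nra.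
move=> d d0.
have q : (a ^ 2 * d %/ b ^ 2 <= d)%N.
  rewrite -[leqRHS](@mulKn d (b ^ 2)) ?expn_gt0 ?b0// leq_div2r// leq_mul2r leq_exp2r//.
  by apply/orP; right; lia.
have -> : \sum_(0 <= c < d.+1) stable_row R a b c d =
    \sum_(0 <= e < d.+1) (e <= a ^ 2 * d %/ b ^ 2)%N%:R * 1.
  rewrite big_nat_rev /=; apply: eq_big_nat => c /andP[_]; rewrite ltnS => cd.
  rewrite mulr1 /stable_row add0n subSS leq_divRL ?expn_gt0 ?b0//.
  have cdb : (c * b ^ 2 <= d * b ^ 2)%N by rewrite leq_mul2r cd orbT.
  rewrite mulnBl (mulnC (b ^ 2)%N) addnC; congr (_%:R); congr nat_of_bool.
  move: cdb; move: (c * b ^ 2)%N (d * b ^ 2)%N (a ^ 2 * d)%N => u v w; lia.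
rewrite (@sum_initial_segment (fun=> 1))// sumr_const_nat subn0 -(natr1 (_ %/ _)).
have [] := @divn_approx R (a ^ 2 * d) (b ^ 2); first by rewrite expn_gt0 b0.
have -> : (a ^ 2 * d)%:R / (b ^ 2)%:R = (a%:R / b%:R) ^+ 2 * d%:R :> R.
  by rewrite natr_sqrM natrX expr_div_n mulrAC.
rewrite (_ : 2 * (_ / 2) * _ = (a%:R / b%:R) ^+ 2 * d%:R); last by field; rewrite gt_eqF.
by move: (_ * d%:R) (_%:R) => u v ? ?; rewrite ler_norml; lra.
Qed.

Lemma homogeneous_inner_row : homogeneous0 R (inner_row R).
Proof. by move=> k a b k0 _; rewrite /inner_row muln_gt0 k0 ltn_pmul2l. Qed.

Lemma inner_row_bound M :
  `|tri_sum R (inner_row R) M - 1 / 2 * M%:R ^+ 2| <= 2 * M%:R.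
Proof.
apply: le_trans (@tri_sum_row_bound _ _ 1 _ _) _; last first.
  by rewrite ler_wpM2r// ger0_norm; lra.
move=> [//|b] _; rewrite big_nat_recr//= big_ltn//.
rewrite /inner_row ltnn ltnS ltnn andbF add0r addr0.
have -> : \sum_(1 <= a < b.+1) (0 < a < b.+1)%N%:R = b%:R :> R.
  transitivity (\sum_(1 <= a < b.+1) 1 : R); first by apply: eq_big_nat => a ->.
  by rewrite sumr_const_nat subn1.
by rewrite -(natr1 b) ler_norml; lra.
Qed.

End RowSums.

(** * Asymptotics *)


Section Asymptotics.
Variable R : realType.

(** The summand 1 keeps the error positive at T = 1, where the logarithm vanishes. *)
Definition count_error (T : nat) : R := T%:R * (1 + ln T%:R).

Lemma ln_natr_ge0 (T : nat) : (0 < T)%N -> 0 <= ln T%:R :> R.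
Proof. by move=> T0; rewrite ln_ge0// ler1n. Qed.

Lemma count_error_ge0 T : (0 < T)%N -> 0 <= count_error T.
Proof. by move=> T0; rewrite mulr_ge0// addr_ge0// ln_natr_ge0. Qed.

Lemma count_error_le_sqr T : (0 < T)%N -> count_error T <= T%:R ^+ 2.
Proof.
move=> T0; rewrite expr2 ler_wpM2l//.
have := @le_ln1Dx R (T%:R - 1); rewrite [1 + (_ - 1)]addrC subrK.
have : 1 <= T%:R :> R by rewrite ler1n.
by move=> T1 /(_ _) h; rewrite -lerBrDl h//; lra.
Qed.

Definition coprime_density : R := 6 / pi ^+ 2.
Local Notation c := coprime_density.

Lemma coprime_density_bounds : 0 < c <= 3 / 2.
Proof.
have p2 := pi_ge2 R; have q4 : 4 <= pi ^+ 2 :> R by nra.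
have q0 : 0 < pi ^+ 2 :> R by lra.
by rewrite /c divr_gt0//= ler_pdivrMr//; lra.
Qed.

Lemma half_count_bound T : (0 < T)%N ->
  `|coprime_tri_sum R (half_row R) T - 1 / 4 * c * T%:R ^+ 2| <= 13 * count_error T.
Proof.
move=> T0; apply: le_trans (coprime_tri_sum_asymptotic _ _ _ _ _ _ (half_row_bound R) T0) _.
  exact: homogeneous_half_row.
by rewrite ler_wpM2r ?count_error_ge0// ger0_norm; lra.
Qed.

Lemma inner_count_bound T : (0 < T)%N ->
  `|coprime_tri_sum R (inner_row R) T - 1 / 2 * c * T%:R ^+ 2| <= 13 * count_error T.
Proof.
move=> T0; apply: le_trans (coprime_tri_sum_asymptotic _ _ _ _ _ _ (inner_row_bound R) T0) _.
  exact: homogeneous_inner_row.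
by rewrite ler_wpM2r ?count_error_ge0// ger0_norm; lra.
Qed.

Lemma square_sum_bound T : (0 < T)%N ->
  `|coprime_tri_sum R (square_row R) T - 1 / 48 * c * T%:R ^+ 2| <= 13 * count_error T.
Proof.
move=> T0; apply: le_trans (coprime_tri_sum_asymptotic _ _ _ _ _ _ (square_row_bound R) T0) _.
  exact: homogeneous_square_row.
by rewrite ler_wpM2r ?count_error_ge0// ger0_norm; lra.
Qed.

Lemma stable_count_bound a b T : (0 < b)%N -> (2 * a <= b)%N -> (0 < T)%N ->
  `|coprime_tri_sum R (stable_row R a b) T - (a%:R / b%:R) ^+ 2 / 2 * c * T%:R ^+ 2|
     <= 13 * count_error T.
Proof.
move=> b0 ab T0.
have FK M := @stable_row_bound R a b M b0 ab.
apply: le_trans (coprime_tri_sum_asymptotic _ _ _ _ _ _ FK T0) _.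
  exact: homogeneous_stable_row.
have br : 0 < b%:R :> R by rewrite ltr0n.
have x0 : 0 <= (a%:R / b%:R : R) by rewrite divr_ge0.
have x1 : (a%:R / b%:R : R) <= 1 by rewrite ler_pdivrMr// mul1r ler_nat; lia.
rewrite ler_wpM2r ?count_error_ge0//; move: x0 x1; move: (a%:R / b%:R) => x x0 x1.
by rewrite ger0_norm; nra.
Qed.

(** A crude bound for use as a factor in products: the main term is at most (1/4) (3/2) T^2, and the
    error at most 13 T^2 by [count_error_le_sqr]. *)
Lemma half_count_le T : (0 < T)%N ->
  0 <= coprime_tri_sum R (half_row R) T <= 14 * T%:R ^+ 2.
Proof.
move=> T0; apply/andP; split.
  by apply: sumr_ge0 => b _; apply: sumr_ge0 => a _; rewrite ler0n.
have := half_count_bound _ T0; have := count_error_le_sqr _ T0; have /andP[c0 c1] := coprime_density_bounds.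
rewrite ler_norml; have := sqr_ge0 (T%:R : R); move: (T%:R ^+ 2) c c0 c1 => S k k0 k1 S0 e /andP[_ h].
by nra.
Qed.

Lemma inner_count_le T : (0 < T)%N ->
  0 <= coprime_tri_sum R (inner_row R) T <= 14 * T%:R ^+ 2.
Proof.
move=> T0; apply/andP; split.
  by apply: sumr_ge0 => b _; apply: sumr_ge0 => a _; rewrite ler0n.
have := inner_count_bound _ T0; have := count_error_le_sqr _ T0; have /andP[c0 c1] := coprime_density_bounds.
rewrite ler_norml; have := sqr_ge0 (T%:R : R); move: (T%:R ^+ 2) c c0 c1 => S k k0 k1 S0 e /andP[_ h].
by nra.
Qed.

Lemma coprime_density_sqr : c ^+ 2 = 36 / pi ^+ 4.
Proof.
by rewrite /c expr_div_n -exprM -natrX.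
Qed.

(** Replacing each inner count by its main term costs 13 E for each of at most 14 T^2 fractions a /
    b, where E is the [count_error]. Evaluating the resulting weighted sum costs 13 E times a
    coefficient below T^2. In all, 182 + 13 <= 200. *)
Lemma N2_bound T : (0 < T)%N ->
  `|(N2 R T)%:R - 3 * T%:R ^+ 4 / (8 * pi ^+ 4)| <= 200 * (T%:R ^+ 2 * count_error T).
Proof.
move=> T0; have /andP[c0 c1] := coprime_density_bounds.
have e0 := count_error_ge0 _ T0.
rewrite (_ : _ - _ =
   ((N2 R T)%:R - c * T%:R ^+ 2 / 2 * coprime_tri_sum R (square_row R) T) +
   c * T%:R ^+ 2 / 2 * (coprime_tri_sum R (square_row R) T - 1 / 48 * c * T%:R ^+ 2)); last first.
  rewrite (_ : 3 * _ / _ = c ^+ 2 / 96 * T%:R ^+ 4); last first.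
    by rewrite coprime_density_sqr; have := pi_gt0 R; move: (pi) => p p0; field; rewrite gt_eqF.
  by move: c => k; field.
apply: le_trans (ler_normD _ _) _.
have sq := square_sum_bound _ T0.
have /andP[A0 A1] := half_count_le _ T0.
have main : `|(N2 R T)%:R - c * T%:R ^+ 2 / 2 * coprime_tri_sum R (square_row R) T| <=
    coprime_tri_sum R (half_row R) T * (13 * count_error T).
  rewrite N2_coprime_sum /coprime_tri_sum big_distrr -sumrB big_distrl /=.
  apply: le_trans (ler_norm_sum _ _ _) _; apply: ler_sum_nat => b /andP[b0 _].
  rewrite big_distrr -sumrB big_distrl /=.
  apply: le_trans (ler_norm_sum _ _ _) _; apply: ler_sum => a _.
  rewrite /square_row (_ : _ - _ = half_row R a b * (coprime_tri_sum R (stable_row R a b) T -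
     (a%:R / b%:R) ^+ 2 / 2 * c * T%:R ^+ 2)); last first.
    by rewrite /coprime_tri_sum; move: c (a%:R / b%:R) => k x; field.
  rewrite normrM ger0_norm ?ler0n// /half_row; case: (leqP (2 * a) b) => ab.
    by rewrite ler_wpM2l// stable_count_bound.
  by rewrite !mul0r.
have sq2 : `|c * T%:R ^+ 2 / 2 * (coprime_tri_sum R (square_row R) T - 1 / 48 * c * T%:R ^+ 2)|
   <= T%:R ^+ 2 * (13 * count_error T).
  rewrite normrM ler_pM//; have := sqr_ge0 (T%:R : R); move: (T%:R ^+ 2) c c1 c0 => S k k1 k0 S0.
  by rewrite ger0_norm; nra.
have : coprime_tri_sum R (half_row R) T * (13 * count_error T) <= 14 * T%:R ^+ 2 * (13 * count_error T).
  by rewrite ler_wpM2r// mulr_ge0.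
have : 0 <= T%:R ^+ 2 * count_error T by rewrite mulr_ge0// exprn_ge0.
move=> k1 k2; apply: le_trans (lerD main sq2) _.
move: k1 k2; set A := coprime_tri_sum _ _ _; clearbody A; lra.
Qed.

(** The product of the two counts is compared with the product of their main terms by changing one
    factor at a time, the other being bounded by 14 T^2 or T^2; 600 covers 200 + 182 + 13. *)
Lemma N1_bound T : (0 < T)%N ->
  `|(N1 R T)%:R - 39 * T%:R ^+ 4 / (8 * pi ^+ 4)| <= 600 * (T%:R ^+ 2 * count_error T).
Proof.
move=> T0; have /andP[c0 c1] := coprime_density_bounds.
have e0 := count_error_ge0 _ T0.
have h2 := N2_bound _ T0.
have hA := half_count_bound _ T0; have hB := inner_count_bound _ T0.
have /andP[B0 B1] := inner_count_le _ T0.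
rewrite N1_coprime_sum; move: hA hB B0 B1.
set A := coprime_tri_sum _ _ _; set B := coprime_tri_sum _ _ _ => hA hB B0 B1.
have S0 := sqr_ge0 (T%:R : R).
rewrite (_ : _ - _ = ((N2 R T)%:R - 3 * T%:R ^+ 4 / (8 * pi ^+ 4)) +
   ((A - 1 / 4 * c * T%:R ^+ 2) * B + 1 / 4 * c * T%:R ^+ 2 * (B - 1 / 2 * c * T%:R ^+ 2))); last first.
  rewrite (_ : 39 * _ / _ = 39 / 288 * c ^+ 2 * T%:R ^+ 4); last first.
    by rewrite coprime_density_sqr; have := pi_gt0 R; move: (pi) => p p0; field; rewrite gt_eqF.
  rewrite (_ : 3 * _ / _ = c ^+ 2 / 96 * T%:R ^+ 4); last first.
    by rewrite coprime_density_sqr; have := pi_gt0 R; move: (pi) => p p0; field; rewrite gt_eqF.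
  by move: c => k; field.
apply: le_trans (ler_normD _ _) _.
have k1 : `|(A - 1 / 4 * c * T%:R ^+ 2) * B| <= (13 * count_error T) * (14 * T%:R ^+ 2).
  by rewrite normrM ler_pM// ger0_norm.
have k2 : `|1 / 4 * c * T%:R ^+ 2 * (B - 1 / 2 * c * T%:R ^+ 2)| <= T%:R ^+ 2 * (13 * count_error T).
  rewrite normrM ler_pM//; move: (T%:R ^+ 2) S0 c c1 c0 => S S0 k c1 c0.
  by rewrite ger0_norm; nra.
have k3 : 0 <= T%:R ^+ 2 * count_error T by rewrite mulr_ge0.
apply: le_trans (lerD h2 (le_trans (ler_normD _ _) (lerD k1 k2))) _.
lra.
Qed.

Lemma N3_bound T : (0 < T)%N ->
  `|(N3 R T)%:R - 3 * T%:R / (2 * pi ^+ 2)| <= 20 * (Num.sqrt T%:R * (1 + ln T%:R)) :> R.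
Proof.
move=> T0; have /andP[c0 c1] := coprime_density_bounds.
have exm : exists m, (T < m.+1 ^ 2)%N by exists T; rewrite -mulnn; nia.
have [m Tm minm] := ex_minnP exm.
have m0 : (0 < m)%N by case: m Tm {minm} => //; rewrite ltnS leqn0 => /eqP Te; rewrite Te in T0.
have mT : (m ^ 2 <= T)%N.
  by case: m m0 Tm minm => // n _ _ minm; rewrite leqNgt; apply/negP => /minm; rewrite ltnn.
rewrite (N3_coprime_sum _ _ m) ?mT//.
have h := half_count_bound _ m0.
have T1 : 1 <= T%:R :> R by rewrite ler1n.
have mr : m%:R <= Num.sqrt T%:R :> R.
  by rewrite -[leLHS]ger0_norm// -sqrtr_sqr -natrX ler_wsqrtr// ler_nat.
have sT : Num.sqrt T%:R <= T%:R :> R.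
  by rewrite -[leRHS]ger0_norm// -sqrtr_sqr ler_wsqrtr// expr2 ler_peMl.
have lnm : ln m%:R <= ln T%:R :> R.
  by rewrite ler_ln ?posrE ?ltr0n// (le_trans mr).
have lm := ln_natr_ge0 _ m0.
have em : count_error m <= Num.sqrt T%:R * (1 + ln T%:R).
  by rewrite /count_error ler_pM// ?lerD2l// addr_ge0.
(* Since T < (m + 1)^2, replacing m^2 by T costs at most 2 m, which the error term absorbs. *)
have sq : `|m%:R ^+ 2 - T%:R| <= 2 * (Num.sqrt T%:R * (1 + ln T%:R)) :> R.
  have m2 : m%:R ^+ 2 <= T%:R :> R by rewrite -natrX ler_nat.
  have m3 : T%:R <= m%:R ^+ 2 + 2 * m%:R :> R.
    by rewrite -natrX -natrM -natrD ler_nat -ltnS; move: Tm; rewrite -!mulnn; lia.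
  have : 0 <= Num.sqrt T%:R * ln T%:R :> R by rewrite mulr_ge0 ?sqrtr_ge0// (le_trans lm).
  by rewrite distrC ger0_norm ?subr_ge0//; lra.
rewrite (_ : 3 * _ / _ = 1 / 4 * c * T%:R); last first.
  by rewrite /c; have := pi_gt0 R; move: (pi) => p p0; field; rewrite gt_eqF.
rewrite (_ : _ - _ = (coprime_tri_sum R (half_row R) m - 1 / 4 * c * m%:R ^+ 2) +
   1 / 4 * c * (m%:R ^+ 2 - T%:R)); last by ring.
apply: le_trans (ler_normD _ _) _.
have k2 : `|1 / 4 * c * (m%:R ^+ 2 - T%:R)| <= 1 * (2 * (Num.sqrt T%:R * (1 + ln T%:R))).
  by rewrite normrM ler_pM// ger0_norm; lra.
apply: le_trans (lerD h k2) _; move: em (count_error_ge0 _ m0).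
by move: (count_error m) (_ * (1 + ln T%:R)) => x y; lra.
Qed.

(** Removes the summand 1 from the error terms: ln (1/2) <= - 1/2 gives ln T >= ln 2 >= 1/2. It
    accounts for the factor 3 between the explicit constants and those fed to [eqaddO_of_bound]. *)
Lemma one_add_ln_le T : (2 <= T)%N -> 1 + ln T%:R <= 3 * ln T%:R :> R.
Proof.
move=> T2; have : 1 / 2 <= ln 2 :> R.
  have := @le_ln1Dx R (- (1 / 2)).
  rewrite (_ : 1 + - (1 / 2) = 2^-1); last by field.
  by rewrite lnV ?posrE//; lra.
have : ln 2 <= ln T%:R :> R by rewrite ler_ln ?posrE ?ltr0n ?(ltn_trans _ T2)// ler_nat.
lra.
Qed.

Lemma eqaddO_of_bound (f g e : nat -> R) (C : R) : 0 <= C ->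
  (forall T, (2 <= T)%N -> `|f T - g T| <= C * e T) ->
  (f : nat -> R^o) = (g : nat -> R^o) +O_\oo (e : nat -> R^o).
Proof.
move=> C0 fg; apply/eqaddOP; near=> k; near=> T.
have T2 : (2 <= T)%N by near: T; exact: nbhs_infty_ge.
apply: le_trans (fg T T2) _; apply: le_trans (ler_wpM2l C0 (ler_norm (e T))) _.
by rewrite ler_wpM2r//; near: k; exact: nbhs_pinfty_ge.
Unshelve. all: by end_near. Qed.

Lemma N1_asymptotic :
  (fun T : nat => (N1 R T)%:R : R^o) =
    (fun T : nat => 39 * T%:R ^+ 4 / (8 * pi ^+ 4) : R^o)
    +O_\oo (fun T : nat => T%:R ^+ 3 * ln T%:R : R^o).
Proof.
apply: (@eqaddO_of_bound _ _ _ 1800); first exact: ler0n.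
move=> T T2.
apply: le_trans (N1_bound _ (ltnW T2)) _.
have := ler_wpM2l (exprn_ge0 3 (ler0n R T)) (one_add_ln_le _ T2).
rewrite /count_error /=; move: (ln T%:R : R) => l; move: (T%:R : R) => t; lra.
Qed.

Lemma N2_asymptotic :
  (fun T : nat => (N2 R T)%:R : R^o) =
    (fun T : nat => 3 * T%:R ^+ 4 / (8 * pi ^+ 4) : R^o)
    +O_\oo (fun T : nat => T%:R ^+ 3 * ln T%:R : R^o).
Proof.
apply: (@eqaddO_of_bound _ _ _ 600); first exact: ler0n.
move=> T T2.
apply: le_trans (N2_bound _ (ltnW T2)) _.
have := ler_wpM2l (exprn_ge0 3 (ler0n R T)) (one_add_ln_le _ T2).
rewrite /count_error /=; move: (ln T%:R : R) => l; move: (T%:R : R) => t; lra.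
Qed.

Lemma N3_asymptotic :
  (fun T : nat => (N3 R T)%:R : R^o) =
    (fun T : nat => 3 * T%:R / (2 * pi ^+ 2) : R^o)
    +O_\oo (fun T : nat => Num.sqrt T%:R * ln T%:R : R^o).
Proof.
apply: (@eqaddO_of_bound _ _ _ 60); first exact: ler0n.
move=> T T2.
apply: le_trans (N3_bound _ (ltnW T2)) _.
have := ler_wpM2l (sqrtr_ge0 (T%:R : R)) (one_add_ln_le _ T2).
move: (ln T%:R : R) (Num.sqrt T%:R : R) => l t /=; lra.
Qed.

(** * The limiting proportion of semi-stable classes *)

Lemma count_error_div_sqr_le T : (0 < T)%N -> count_error T / T%:R ^+ 2 <= 3 / Num.sqrt T%:R.
Proof.
move=> T0; have T1 : 1 <= T%:R :> R by rewrite ler1n.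
set s := Num.sqrt T%:R; have sE : T%:R = s ^+ 2 by rewrite sqr_sqrtr.
have s1 : 1 <= s by rewrite -sqrtr1 ler_wsqrtr.
have s0 : 0 < s by lra.
(* Applying ln s < s to the square root s of T, where ln T = 2 ln s, leaves a decay of order 1 /
   s. *)
have ls := ln_sublinear s0.
have lE : ln (T%:R : R) = ln s + ln s by rewrite sE lnXn// mulr2n.
rewrite /count_error lE sE (_ : _ / _ = (1 + (ln s + ln s)) / s / s); last first.
  by field; rewrite gt_eqF.
by rewrite ler_pM2r ?invr_gt0// ler_pdivrMr//; lra.
Qed.

Lemma cvg_of_sqrt_bound (f : nat -> R) (l C : R) : 0 < C ->
  (forall T, (0 < T)%N -> `|f T - l| <= C / Num.sqrt T%:R) -> f T @[T --> \oo] --> l.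
Proof.
move=> C0 fl; apply/cvgrPdist_le => e e0; near=> T.
have T0 : (0 < T)%N by near: T; exact: nbhs_infty_gt.
rewrite distrC; apply: le_trans (fl T T0) _.
rewrite ler_pdivrMr ?sqrtr_gt0 ?ltr0n// mulrC -ler_pdivrMr//.
rewrite -[leLHS]ger0_norm ?divr_ge0 ?(ltW C0) ?(ltW e0)// -sqrtr_sqr ler_wsqrtr//.
by near: T; exact: nbhs_infty_ger.
Unshelve. all: by end_near. Qed.

Lemma cvg_N2_div_N1 : (N2 R T)%:R / (N1 R T)%:R @[T --> \oo] --> (1 / 13 : R).
Proof.
have p0 : 0 < pi ^+ 4 :> R by rewrite exprn_gt0 ?pi_gt0.
(* Dividing by T^4 turns either explicit bound into a limit; it is stated once to serve both N1 and
   N2. *)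
have b N (k C : R) : 0 < C ->
   (forall T, (0 < T)%N -> `|(N T)%:R - k * T%:R ^+ 4 / (8 * pi ^+ 4)| <= C * (T%:R ^+ 2 * count_error T)) ->
   (N T)%:R / T%:R ^+ 4 @[T --> \oo] --> k / (8 * pi ^+ 4).
  move=> C0 h; apply: (@cvg_of_sqrt_bound _ _ (3 * C)) => [|T T0]; first by rewrite mulr_gt0.
  have T1 : 0 < T%:R :> R by rewrite ltr0n.
  have T4 : 0 < T%:R ^+ 4 :> R by rewrite exprn_gt0.
  rewrite (_ : _ - _ = ((N T)%:R - k * T%:R ^+ 4 / (8 * pi ^+ 4)) / T%:R ^+ 4); last first.
    by move: (pi ^+ 4) p0 => p p0; field; rewrite !gt_eqF.
  rewrite normf_div [X in _ / X]gtr0_norm// ler_pdivrMr//; apply: le_trans (h T T0) _.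
  have := count_error_div_sqr_le _ T0; rewrite ler_pdivrMr ?exprn_gt0// => h2.
  rewrite [leRHS](_ : _ = C * (T%:R ^+ 2 * (3 / Num.sqrt T%:R * T%:R ^+ 2))); last by ring.
  by rewrite ler_wpM2l ?(ltW C0)// ler_wpM2l// exprn_ge0.
have c1 : (N1 R T)%:R / T%:R ^+ 4 @[T --> \oo] --> (39 / (8 * pi ^+ 4) : R).
  by apply: b N1_bound; rewrite ltr0n.
have c2 : (N2 R T)%:R / T%:R ^+ 4 @[T --> \oo] --> (3 / (8 * pi ^+ 4) : R).
  by apply: b N2_bound; rewrite ltr0n.
have n0 : 39 / (8 * pi ^+ 4) != 0 :> R by rewrite gt_eqF// divr_gt0// mulr_gt0.
have -> : 1 / 13 = 3 / (8 * pi ^+ 4) / (39 / (8 * pi ^+ 4)) :> R.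
  by move: (pi ^+ 4) p0 => p p0; field; rewrite gt_eqF.
apply: cvg_trans (cvgM c2 (cvgV n0 c1)); apply: near_eq_cvg; near=> T.
have T0 : (0 < T)%N by near: T; exact: nbhs_infty_gt.
have T4 : T%:R ^+ 4 != 0 :> R by rewrite expf_neq0// pnatr_eq0 -lt0n.
by rewrite /GRing.mul_fun /= invf_div mulrA divfK.
Unshelve. all: by end_near. Qed.

(** * Decimal expansions of the leading constants *)

Lemma ltr_exp4_bounds (l x u : R) : 0 < l -> l < x < u -> l ^+ 4 < x ^+ 4 < u ^+ 4.
Proof.
move=> l0 /andP[lx xu]; have x0 := lt_trans l0 lx.
by rewrite !ltrXn2r// ?nnegrE ?(ltW l0) ?(ltW x0) ?(ltW (lt_trans x0 xu)).
Qed.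

(** The bounds on pi differ by 2 / 10^11, so they fix pi^4 to a relative precision below 3 / 10^11,
    finer than the eleven decimals require. *)
Lemma decimal_prefix_39_div_8pi4 : decimal_prefix [:: 0; 5; 0; 0; 4; 6; 6; 6; 3; 4; 9]%N
    (39 / (8 * pi ^+ 4) : R).
Proof.
have l0 : 0 < 3 + 1415 / 10 ^+ 4 + 9265 / 10 ^+ 8 + 358 / 10 ^+ 11 :> R by lra.
have /andP[l u] := ltr_exp4_bounds _ _ _ l0 (pi_bounds R).
have p0 : 0 < pi ^+ 4 :> R by rewrite exprn_gt0 ?pi_gt0.
rewrite /decimal_prefix !big_ord_recl big_ord0 /=.
move: (pi ^+ 4) p0 l u => p p0 l u.
by rewrite ler_pdivlMr ?ltr_pdivrMr ?mulr_gt0//; apply/andP; split; lra.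
Qed.

Lemma decimal_prefix_3_div_8pi4 : decimal_prefix [:: 0; 0; 3; 8; 4; 9; 7; 4; 3; 3; 4]%N
    (3 / (8 * pi ^+ 4) : R).
Proof.
have l0 : 0 < 3 + 1415 / 10 ^+ 4 + 9265 / 10 ^+ 8 + 358 / 10 ^+ 11 :> R by lra.
have /andP[l u] := ltr_exp4_bounds _ _ _ l0 (pi_bounds R).
have p0 : 0 < pi ^+ 4 :> R by rewrite exprn_gt0 ?pi_gt0.
rewrite /decimal_prefix !big_ord_recl big_ord0 /=.
move: (pi ^+ 4) p0 l u => p p0 l u.
by rewrite ler_pdivlMr ?ltr_pdivrMr ?mulr_gt0//; apply/andP; split; lra.
Qed.

End Asymptotics.

Theorem theorem1p1 (R : realType) :
  (forall T : nat, (2 <= T)%N -> (N3 R T < N2 R T < N1 R T)%N) /\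
  (fun T : nat => (N1 R T)%:R : R^o) =
    (fun T : nat => 39 * T%:R ^+ 4 / (8 * pi ^+ 4) : R^o)
    +O_\oo (fun T : nat => T%:R ^+ 3 * ln T%:R : R^o) /\
  (fun T : nat => (N2 R T)%:R : R^o) =
    (fun T : nat => 3 * T%:R ^+ 4 / (8 * pi ^+ 4) : R^o)
    +O_\oo (fun T : nat => T%:R ^+ 3 * ln T%:R : R^o) /\
  (fun T : nat => (N3 R T)%:R : R^o) =
    (fun T : nat => 3 * T%:R / (2 * pi ^+ 2) : R^o)
    +O_\oo (fun T : nat => Num.sqrt T%:R * ln T%:R : R^o) /\
  decimal_prefix [:: 0; 5; 0; 0; 4; 6; 6; 6; 3; 4; 9]%N
    (39 / (8 * pi ^+ 4) : R) /\
  decimal_prefix [:: 0; 0; 3; 8; 4; 9; 7; 4; 3; 3; 4]%N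
    (3 / (8 * pi ^+ 4) : R) /\
  (exists2 p : R, `|p - 77 / 1000| < 5 / 10000 &
    (N2 R T)%:R / (N1 R T)%:R @[T --> \oo] --> p).
Proof.
split; first exact: N3_lt_N2_lt_N1.
split; first exact: N1_asymptotic.
split; first exact: N2_asymptotic.
split; first exact: N3_asymptotic.
split; first exact: decimal_prefix_39_div_8pi4.
split; first exact: decimal_prefix_3_div_8pi4.
(* 1/13 = 0.0769..., within half a unit of the last digit of 7.7 percent. *)
exists (1 / 13); last exact: cvg_N2_div_N1.
by rewrite ltr_norml; lra.
Qed.
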